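(* Let $K/\mathbb{Q}(\sqrt{3})$ be a field extension of finite degree $d\ge 1$ with $K$ totally real. Then there exist infinitely many pairwise non-commensurable semi-arithmetic cocompact Fuchsian groups contained in $\mathrm{PSL}(2,K)$.
   Context: A Fuchsian group is a discrete subgroup $\Gamma<\mathrm{PSL}(2,\mathbb{R})$; it is cocompact if $\Gamma\backslash\mathbb{H}$ is compact. $K$ is regarded as a subfield of $\mathbb{R}$, so that $\mathrm{PSL}(2,K)\subset\mathrm{PSL}(2,\mathbb{R})$. Let $\Gamma^{(2)}=\langle\gamma^2\mid\gamma\in\Gamma\rangle$ and let $k\Gamma=\mathbb{Q}(\mathrm{tr}\,\Gamma^{(2)})$ be the invariant trace field. $\Gamma$ is semi-arithmetic if $\Gamma\backslash\mathbb{H}$ has finite hyperbolic area, $k\Gamma$ is a totally real number field, and the traces of all elements of $\Gamma$ are algebraic integers. Two Fuchsian groups $\Gamma_1,\Gamma_2$ are commensurable if for some $g\in\mathrm{PSL}(2,\mathbb{R})$ the group $\Gamma_1\cap g\Gamma_2g^{-1}$ has finite index in both $\Gamma_1$ and $g\Gamma_2g^{-1}$. *)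

(* Defs.v *)
From HB Require Import structures.
From mathcomp Require Import all_boot all_order all_algebra all_field.
From mathcomp Require Import generic_quotient.
From mathcomp Require Import complex ring.
From mathcomp Require Import all_classical all_reals all_analysis.
Import numFieldNormedType.Exports.

Set Implicit Arguments.
Unset Strict Implicit.
Unset Printing Implicit Defensive.

Import Order.TTheory GRing.Theory Num.Theory.

Local Open Scope quotient_scope.
Local Open Scope classical_set_scope.
Local Open Scope complex_scope.
Local Open Scope group_scope.
Local Open Scope ring_scope.

(* [set_type] carries the subspace topology, here that of 'M[R]_2 *)
Definition SL2 (R : realType) : Type := set_type [set A : 'M[R]_2 | \det A = 1].

Section SL2_group.
Variable R : realType.

HB.instance Definition _ := Choice.on (SL2 R).
HB.instance Definition _ := Topological.on (SL2 R).

Definition SL2_mx (A : SL2 R) : 'M[R]_2 := set_val A.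

Lemma SL2_mx_inj : injective SL2_mx.
Proof. exact: val_inj. Qed.

Lemma det_SL2 (A : SL2 R) : \det (SL2_mx A) = 1.
Proof. exact: (set_valP A). Qed.

Lemma SL2_unit (A : SL2 R) : SL2_mx A \in unitmx.
Proof. by rewrite unitmxE det_SL2 unitr1. Qed.

Definition mkSL2 (A : 'M[R]_2) (hA : \det A = 1) : SL2 R := SigSub (mem_set hA).

Lemma mkSL2K (A : 'M[R]_2) (hA : \det A = 1) : SL2_mx (mkSL2 hA) = A.
Proof. by rewrite /SL2_mx set_valE. Qed.

Fact det_SL2_1 : \det (1%:M : 'M[R]_2) = 1. Proof. exact: det1. Qed.
Fact det_SL2_M (A B : SL2 R) : \det (SL2_mx A *m SL2_mx B) = 1.
Proof. by rewrite det_mulmx !det_SL2 mulr1. Qed.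
Fact det_SL2_V (A : SL2 R) : \det (invmx (SL2_mx A)) = 1.
Proof. by rewrite det_inv det_SL2 invr1. Qed.
Fact det_SL2_N (A : SL2 R) : \det (- SL2_mx A) = 1.
Proof. by rewrite -scaleN1r detZ det_SL2 expr2 mulr1 mulrN1 opprK. Qed.

Definition SL2_one : SL2 R := mkSL2 det_SL2_1.
Definition SL2_mul (A B : SL2 R) : SL2 R := mkSL2 (det_SL2_M A B).
Definition SL2_inv (A : SL2 R) : SL2 R := mkSL2 (det_SL2_V A).
Definition SL2_opp (A : SL2 R) : SL2 R := mkSL2 (det_SL2_N A).

Fact SL2_mulA : associative SL2_mul.
Proof. by move=> A B C; apply: SL2_mx_inj; rewrite !mkSL2K mulmxA. Qed.
Fact SL2_mul1 : left_id SL2_one SL2_mul.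
Proof. by move=> A; apply: SL2_mx_inj; rewrite !mkSL2K mul1mx. Qed.
Fact SL2_mulr1 : right_id SL2_one SL2_mul.
Proof. by move=> A; apply: SL2_mx_inj; rewrite !mkSL2K mulmx1. Qed.
Fact SL2_mulV : left_inverse SL2_one SL2_inv SL2_mul.
Proof. by move=> A; apply: SL2_mx_inj; rewrite !mkSL2K mulVmx ?SL2_unit. Qed.
Fact SL2_mulrV : right_inverse SL2_one SL2_inv SL2_mul.
Proof. by move=> A; apply: SL2_mx_inj; rewrite !mkSL2K mulmxV ?SL2_unit. Qed.

HB.instance Definition _ := isGroup.Build (SL2 R)
  SL2_mulA SL2_mul1 SL2_mulr1 SL2_mulV SL2_mulrV.

Lemma SL2_mxM (A B : SL2 R) : SL2_mx (A * B)%g = SL2_mx A *m SL2_mx B.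
Proof. exact: mkSL2K. Qed.

Definition pm_eq (A B : SL2 R) : bool := (A == B) || (A == SL2_opp B).

Lemma SL2_oppK : involutive SL2_opp.
Proof. by move=> A; apply: SL2_mx_inj; rewrite !mkSL2K opprK. Qed.

Lemma SL2_oppMl (A B : SL2 R) : (SL2_opp A * B)%g = SL2_opp (A * B)%g.
Proof. by apply: SL2_mx_inj; rewrite SL2_mxM !mkSL2K mulNmx. Qed.

Lemma SL2_oppMr (A B : SL2 R) : (A * SL2_opp B)%g = SL2_opp (A * B)%g.
Proof. by apply: SL2_mx_inj; rewrite SL2_mxM !mkSL2K mulmxN. Qed.

Fact pm_eq_refl : reflexive pm_eq.
Proof. by move=> A; rewrite /pm_eq eqxx. Qed.
Fact pm_eq_sym : symmetric pm_eq.
Proof.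
move=> A B; rewrite /pm_eq eq_sym; congr (_ || _).
by apply/eqP/eqP => ->; rewrite SL2_oppK.
Qed.
Fact pm_eq_trans : transitive pm_eq.
Proof.
move=> B A C /orP[]/eqP-> // /orP[]/eqP->.
  by rewrite /pm_eq eqxx orbT.
by rewrite SL2_oppK /pm_eq eqxx.
Qed.

Canonical pm_equiv := EquivRel pm_eq pm_eq_refl pm_eq_sym pm_eq_trans.

End SL2_group.

Definition PSL2 (R : realType) : Type := quotient_topology {eq_quot @pm_equiv R}.

Section PSL2_group.
Variable R : realType.

HB.instance Definition _ := Choice.on (PSL2 R).
HB.instance Definition _ := Topological.on (PSL2 R).
HB.instance Definition _ := Quotient.on (PSL2 R).

Lemma eq_PSL2 (A B : SL2 R) : (\pi_(PSL2 R) A = \pi_(PSL2 R) B) <-> pm_eq A B.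
Proof. by split => [/eqmodP|?]; last exact/eqmodP. Qed.

Definition PSL2_one : PSL2 R := \pi_(PSL2 R) 1%g.
Definition PSL2_mul (x y : PSL2 R) : PSL2 R := \pi_(PSL2 R) (repr x * repr y)%g.
Definition PSL2_inv (x : PSL2 R) : PSL2 R := \pi_(PSL2 R) (repr x)^-1%g.

Lemma pi_PSL2_mul (A B : SL2 R) : PSL2_mul (\pi_(PSL2 R) A) (\pi_(PSL2 R) B) = \pi_(PSL2 R) (A * B)%g.
Proof.
apply/eq_PSL2; have /eq_PSL2 hA := reprK (\pi_(PSL2 R) A).
have /eq_PSL2 hB := reprK (\pi_(PSL2 R) B).
case/orP: hA => /eqP ->; case/orP: hB => /eqP ->;
by rewrite /pm_eq ?SL2_oppMl ?SL2_oppMr ?SL2_oppK eqxx ?orbT.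
Qed.

Fact PSL2_mulA : associative PSL2_mul.
Proof.
move=> x y z; rewrite -[x]reprK -[y]reprK -[z]reprK.
move: (repr x) (repr y) (repr z) => A B C.
by rewrite (pi_PSL2_mul A B) (pi_PSL2_mul B C) !pi_PSL2_mul mulgA.
Qed.
Fact PSL2_mul1 : left_id PSL2_one PSL2_mul.
Proof. by move=> x; rewrite -[x]reprK pi_PSL2_mul mul1g. Qed.
Fact PSL2_mulr1 : right_id PSL2_one PSL2_mul.
Proof. by move=> x; rewrite -[x]reprK pi_PSL2_mul mulg1. Qed.
Fact PSL2_mulV : left_inverse PSL2_one PSL2_inv PSL2_mul.
Proof. by move=> x; rewrite -{2}[x]reprK pi_PSL2_mul mulVg. Qed.
Fact PSL2_mulrV : right_inverse PSL2_one PSL2_inv PSL2_mul.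
Proof. by move=> x; rewrite -{1}[x]reprK pi_PSL2_mul mulgV. Qed.

HB.instance Definition _ := isGroup.Build (PSL2 R)
  PSL2_mulA PSL2_mul1 PSL2_mulr1 PSL2_mulV PSL2_mulrV.

Lemma pi_PSL2M (A B : SL2 R) :
  \pi_(PSL2 R) (A * B)%g = (\pi_(PSL2 R) A * \pi_(PSL2 R) B)%g.
Proof. by rewrite -pi_PSL2_mul. Qed.

End PSL2_group.

(* [complex.Im] is the R-valued imaginary part ([Im] alone is R[i]-valued);
   R[i]^o is R[i] with the topology of its norm *)
Definition upper_half_plane (R : realType) : Type :=
  set_type [set z : R[i]^o | 0 < complex.Im z].

Section mobius.
Variable R : realType.
Local Notation H := (upper_half_plane R).

HB.instance Definition _ := Choice.on H.
HB.instance Definition _ := Topological.on H.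

Definition hp_val (z : H) : R[i] := set_val z.

Definition homography (A : 'M[R]_2) (z : R[i]) : R[i] :=
  ((A 0 0)%:C * z + (A 0 1)%:C) / ((A 1 0)%:C * z + (A 1 1)%:C).

Lemma hp_valP (z : H) : 0 < complex.Im (hp_val z).
Proof. exact: (set_valP z). Qed.

Fact det_mx2 (A : 'M[R]_2) : \det A = A 0 0 * A 1 1 - A 0 1 * A 1 0.
Proof.
rewrite (expand_det_row _ 0) !big_ord_recl big_ord0 addr0 /cofactor.
rewrite !det_mx11 !mxE /= expr0 expr1 mul1r mulN1r mulrN.
by congr (_ * A _ _ - A _ _ * A _ _); apply/val_inj.
Qed.

Fact homography_Im (A : SL2 R) (z : H) :
  0 < complex.Im (homography (SL2_mx A) (hp_val z)).
Proof.
have := det_SL2 A; have := hp_valP z; rewrite /homography det_mx2.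
move: (SL2_mx A) (hp_val z) => {}A [x y] /=.
move: (A 0 0) (A 0 1) (A 1 0) (A 1 1) => a b c d y0 adbc.
rewrite !mul0r !addr0 !subr0.
set u := c * x + d; set v := c * y; set n := u ^+ 2 + v ^+ 2.
have n0 : 0 < n.
  rewrite /n lt_def paddr_eq0 ?sqr_ge0// addr_ge0 ?sqr_ge0// andbT.
  rewrite !sqrf_eq0 mulf_eq0 (gt_eqF y0) orbF /u; apply/negP => /andP[+ /eqP c0].
  rewrite c0 mul0r add0r => /eqP d0; move: adbc.
  by rewrite c0 d0 !mulr0 subrr => /esym/eqP; rewrite oner_eq0.
have -> : (a * x + b) * - (v / n) + a * y * (u / n) = y / n.
  transitivity ((a * d - b * c) * y / n); last by rewrite adbc mul1r.
  by rewrite /u /v; ring.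
exact: divr_gt0.
Qed.

Definition mkH (z : R[i]) (hz : 0 < complex.Im z) : H :=
  SigSub (@mem_set _ [set w : R[i]^o | 0 < complex.Im w] z hz).

Definition SL2_act (A : SL2 R) (z : H) : H := mkH (homography_Im A z).

(* independent of the representative, see [act_pi] *)
Definition act (g : PSL2 R) (z : H) : H := SL2_act (repr g) z.

Lemma act_pi (A : SL2 R) (z : H) : act (\pi_(PSL2 R) A) z = SL2_act A z.
Proof.
have /eq_PSL2 hA := reprK (\pi_(PSL2 R) A); rewrite /act.
case/orP: hA => /eqP -> //; apply: val_inj => /=; rewrite /homography mkSL2K !mxE !rmorphN !mulNr -!opprD.
by rewrite invrN mulrNN.
Qed.

End mobius.

Section Fuchsian.
Variable R : realType.
Local Notation H := (upper_half_plane R).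
Implicit Types (G : set (PSL2 R)) (F : set H).

Definition fuchsian G : Prop := group_closed (mem G) /\ G `<=` isolated G.

Definition hp_orbit G (z : H) : set H := [set act g z | g in G].

(* comparing orbits gives an equivalence for every G; for a subgroup G,
   [same_orbit G z w] holds iff w = act g z for some g in G *)
Definition same_orbit G (z w : H) : bool := `[< hp_orbit G z = hp_orbit G w >].

Fact same_orbit_refl G : reflexive (same_orbit G).
Proof. by move=> z; apply/asboolP. Qed.
Fact same_orbit_sym G : symmetric (same_orbit G).
Proof. by move=> z w; apply/asboolP/asboolP. Qed.
Fact same_orbit_trans G : transitive (same_orbit G).
Proof. by move=> y x z /asboolP xy /asboolP yz; apply/asboolP; rewrite xy. Qed.

Canonical same_orbit_equiv G := EquivRel (same_orbit G)
  (@same_orbit_refl G) (@same_orbit_sym G) (@same_orbit_trans G).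

Definition orbit_space G : Type := quotient_topology {eq_quot same_orbit_equiv G}.

HB.instance Definition _ G := Topological.on (orbit_space G).

Definition cocompact G : Prop := compact [set: orbit_space G].

Definition hp_coords (z : H) : measurableTypeR R * measurableTypeR R :=
  (complex.Re (hp_val z), complex.Im (hp_val z)).

Definition hyperbolic_area (F : set H) : \bar R :=
  (\int[lebesgue_measure \x lebesgue_measure]_(p in hp_coords @` F)
     (p.2 ^- 2)%:E)%E.

Definition fundamental_domain G F : Prop :=
  [/\ measurable (hp_coords @` F),
      forall z, exists2 g, G g & F (act g z) &
      forall g, G g -> g <> 1%g -> hyperbolic_area (F `&` (act g @` F)) = 0%E].

(* the area of G\H is that of any of its fundamental domains *)
Definition finite_area G : Prop :=
  exists2 F, fundamental_domain G F & (hyperbolic_area F < +oo)%E.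

(* the trace of an element of PSL(2, R) is only defined up to sign: both signs
   are taken *)
Definition traces G : set R := [set \tr (SL2_mx A) | A in [set A | G (\pi_(PSL2 R) A)]].

Definition algebraic_integer (x : R) : Prop := integralOver (intr : int -> R) x.

Definition square_subgroup G : set (PSL2 R) :=
  smallest [set S : set (PSL2 R) | group_closed (mem S)] [set (g ^+ 2)%g | g in G].

(* the field Q(S): subfields of R automatically contain Q *)
Definition generated_field (S : set R) : set R :=
  smallest [set M : set R | divring_closed (mem M)] S.

Definition invariant_trace_field G : set R :=
  generated_field (traces (square_subgroup G)).

End Fuchsian.

(* every field embedding of the number field L in C = R[i] has real image *)
Definition totally_real (R : realType) (L : fieldExtType rat) : Prop :=
  forall (s : {rmorphism L -> R[i]}) (x : L), complex.Im (s x) = 0.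

Definition totally_real_number_field (R : realType) (k : set R) : Prop :=
  exists (L : fieldExtType rat) (f : {rmorphism L -> R}),
    range f = k /\ totally_real R L.

Definition semi_arithmetic (R : realType) (G : set (PSL2 R)) : Prop :=
  [/\ fuchsian G, finite_area G,
      totally_real_number_field (invariant_trace_field G) &
      traces G `<=` @algebraic_integer R].

Definition finite_index (T : groupType) (S G : set T) : Prop :=
  finite_set [set [set (g * s)%g | s in S] | g in G].

Definition conjugate (T : groupType) (G : set T) (g : T) : set T :=
  [set (g * x * g^-1)%g | x in G].

Definition commensurable (R : realType) (G1 G2 : set (PSL2 R)) : Prop :=
  exists g : PSL2 R,
    finite_index (G1 `&` conjugate G2 g) G1 /\
    finite_index (G1 `&` conjugate G2 g) (conjugate G2 g).

(* the image of PSL(2, K) in PSL(2, R), K being embedded in R by f *)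
Definition PSL2_over (R : realType) (K : fieldExtType rat)
    (f : {rmorphism K -> R}) : set (PSL2 R) :=
  [set \pi_(PSL2 R) A | A in [set A : SL2 R | exists B : 'M[K]_2, SL2_mx A = map_mx f B]].

(* Main.v *)
Require Import Defs.
From mathcomp Require Import all_boot all_order all_algebra all_field.
From mathcomp Require Import generic_quotient complex.
From mathcomp Require Import all_classical all_reals all_analysis.
From mathcomp Require Import measurable_realfun.
From mathcomp Require Import zify ring lra.

(** For a prime [p] inert in [Q(sqrt 3)] the quaternion algebra [(3, p)] over
    [Q] is a division algebra split by [Q(sqrt 3)], so the norm-one group of
    the order [Z<i, j>], [i ^ 2 = 3], [j ^ 2 = p], embeds in
    [SL(2, Q(sqrt 3))], whatever [K] is; all its traces are integers, so the
    invariant trace field is [Q].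

    It is cocompact by Hermite's argument.  Given [z] in the half-plane, the
    pigeonhole principle yields a nonzero [x] in the order whose rows are short
    at [z]; its norm is bounded, and nonzero by anisotropy, and elements with
    the same norm [n] and the same residue modulo [n] differ by a unit, so
    finitely many [y] suffice to write [y x = n r] with [r] in the group; then
    [r z] lies in a fixed compact box.  The lexicographically smallest points
    of the orbits in that box form a fundamental domain of finite area.

    If the groups of [p] and [q] are commensurable, a power of the unit
    [2 + sqrt 3] and a second, non-commuting element lie in a common subgroup.
    Their commutator [X Y - Y X] anticommutes with a square root of [3 b ^ 2] in
    both algebras, hence its norm is [- p] and [- q] times a norm from
    [Q(sqrt 3)], and the parity of the valuation at [p] forces [p = q]. *)

Set Implicit Arguments.
Unset Strict Implicit.
Unset Printing Implicit Defensive.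

Import Order.TTheory GRing.Theory Num.Theory.
Import numFieldNormedType.Exports.
Local Open Scope quotient_scope.
Local Open Scope classical_set_scope.
Local Open Scope ring_scope.

(** * Primes inert in the field of sqrt 3 *)

(** The second clause says that the norm form of Z[sqrt 3] is anisotropic modulo [p]; it excludes
    the ramified primes 2 and 3. *)
Definition inert3 (p : nat) : Prop :=
  prime p /\ forall a b : int, (p %| a ^+ 2 - 3 * b ^+ 2)%Z -> (p %| a)%Z && (p %| b)%Z.

Lemma intr_Fp_eq0 (p : nat) (a : int) : prime p -> (a%:~R == 0 :> 'F_p) = (p %| a)%Z.
Proof.
move=> p_pr; have pch : p \in [pchar 'F_p] by rewrite pchar_Fp.
have natE n : (n%:R == 0 :> 'F_p) = (p %| n)%N by rewrite -(dvdn_pcharf pch).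
case: a => n; first by have -> : (n%:Z)%:~R = n%:R :> 'F_p by []; rewrite natE.
have -> : (Negz n)%:~R = - n.+1%:R :> 'F_p by rewrite NegzE mulrNz.
by rewrite oppr_eq0 natE dvdzE.
Qed.

(* [(x i - 1) / 2] would be a primitive cube root of unity, but 3 does not
   divide [p - 1]. *)
Lemma sqrt3_Fp (p : nat) (x i : 'F_p) :
  prime p -> p != 2%N -> (p %% 3 = 2)%N -> i ^+ 2 = -1 -> x ^+ 2 = 3 -> False.
Proof.
move=> p_pr p2 p3 i2 x2.
have pch : p \in [pchar 'F_p] by rewrite pchar_Fp.
have two0 : (2 : 'F_p) != 0 by rewrite -(dvdn_pcharf pch) dvdn_prime2.
have three0 : (3 : 'F_p) != 0.
  by rewrite -(dvdn_pcharf pch) dvdn_prime2 //; apply/eqP => p_3; rewrite p_3 in p3.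
pose t := x * i; have t2 : t ^+ 2 = -3 by rewrite exprMn x2 i2; ring.
pose w := (t - 1) / 2.
have w3 : w ^+ 3 = 1.
  rewrite expr_div_n; have -> : (t - 1) ^+ 3 = 2 ^+ 3 by ring: t2.
  by rewrite divff // expf_neq0.
have wp : w ^+ p = w by have := expf_card w; rewrite card_Fp.
have w21 : w ^+ 2 = w.
  have -> : w ^+ 2 = w ^+ (p %/ 3 * 3 + p %% 3).
    by rewrite exprD mulnC exprM w3 expr1n mul1r p3.
  by rewrite -divn_eq.
have w0 : w != 0 by apply/eqP => w0; move: w3; rewrite w0 expr0n /= => /esym/eqP; rewrite oner_eq0.
have w1 : w = 1 by apply: (mulIf w0); rewrite -expr2 w21 mul1r.
have t3 : t = 3.
  have : w * 2 = 2 by rewrite w1 mul1r.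
  rewrite /w divfK // => /eqP; rewrite subr_eq => /eqP ->; ring.
move: t2; rewrite t3 => /eqP; rewrite -subr_eq0.
have -> : 3 ^+ 2 - - 3 = 2 * 2 * 3 :> 'F_p by ring.
by rewrite !mulf_eq0 (negbTE two0) (negbTE three0).
Qed.

(** Modulo [p], [2 y] is a square root of -1, and a zero of the norm form with [b] nonzero would
    make [a / b] a square root of 3. *)
Lemma inert3_dvd (p y : nat) :
  prime p -> (p %% 3 = 2)%N -> (p %| 4 * y ^ 2 + 1)%N -> inert3 p.
Proof.
move=> p_pr p3 pdvd; split=> // a b.
have p2 : p != 2%N.
  by apply: contraL pdvd => /eqP ->; rewrite dvdn2 oddD oddM.
have pch : p \in [pchar 'F_p] by rewrite pchar_Fp.
rewrite -!intr_Fp_eq0 // rmorphB rmorphXn rmorphM rmorphXn /=.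
set u : 'F_p := a%:~R; set v : 'F_p := b%:~R.
rewrite subr_eq0 => /eqP uv.
case: (eqVneq v 0) => [v0|v0].
  by move: uv; rewrite v0 expr0n mulr0 andbT => /eqP; rewrite sqrf_eq0.
exfalso; apply: (@sqrt3_Fp p (u / v) (2 * y%:R)) => //.
  rewrite exprMn; apply/eqP; rewrite -addr_eq0.
  have -> : 2 ^+ 2 * y%:R ^+ 2 + 1 = (4 * y ^ 2 + 1)%:R :> 'F_p.
    by rewrite natrD natrM natrX; ring.
  by rewrite -(dvdn_pcharf pch).
by rewrite expr_div_n uv mulfK // expf_neq0.
Qed.

(** A product of primes congruent to 0 or 1 modulo 3 is never congruent to 2. *)
Lemma prime_mod3_2 (n : nat) : (n %% 3 = 2)%N -> exists2 p, prime p & (p %| n)%N && (p %% 3 == 2)%N.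
Proof.
have [m] := ubnP n; elim: m n => // m IHm n nm n3.
have n1 : (1 < n)%N by case: n n3 {nm} => [|[|]].
case: (boolP (pdiv n %% 3 == 2)%N) => p3.
  by exists (pdiv n); rewrite ?pdiv_prime // pdiv_dvd.
have := divnK (pdiv_dvd n); set q := (n %/ _)%N => qE.
have [||p pp /andP[pq pm]] := IHm q.
- have qn : (q < n)%N by rewrite ltn_Pdiv ?prime_gt1 ?pdiv_prime // ltnW.
  exact: leq_trans qn nm.
- have := n3; rewrite -qE -modnMm.
  have : (pdiv n %% 3 < 3)%N by rewrite ltn_mod.
  have : (q %% 3 < 3)%N by rewrite ltn_mod.
  move: p3; case: (pdiv n %% 3)%N => [|[|[|]]] //; by case: (q %% 3)%N => [|[|[|]]].
by exists p => //; rewrite pm -qE dvdn_mulr.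
Qed.

(** Euclid's argument: [y] is the product of the numbers up to [m] prime to 3, so [4 y ^ 2 + 1] is 2
    modulo 3 and shares no prime factor with [y]. *)
Lemma exists_inert3 (m : nat) : exists2 p, inert3 p & (m < p)%N.
Proof.
pose y := (\prod_(1 <= k < m.+1 | ~~ (3 %| k)) k)%N.
have y3 : ~~ (3 %| y)%N.
  rewrite /y; elim/big_ind: _ => // a b a3 b3; by rewrite Euclid_dvdM // negb_or a3.
have n3 : ((4 * y ^ 2 + 1) %% 3 = 2)%N.
  rewrite -modnDml -modnMml -modnMmr -modnXm.
  move: y3; rewrite /dvdn; have : (y %% 3 < 3)%N by rewrite ltn_mod.
  by case: (y %% 3)%N => [|[|[|]]].
have [p pp /andP[pn /eqP p3]] := prime_mod3_2 n3.
exists p; first exact: inert3_dvd pn.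
rewrite ltnNge; apply/negP => pm.
suff py : (p %| y)%N.
  have : (p %| 1)%N.
    rewrite -(dvdn_addr 1 (_ : p %| 4 * y ^ 2)%N) //.
    by rewrite dvdn_mull // expnS dvdn_mulr.
  by rewrite dvdn1 => /eqP p1; rewrite p1 in pp.
rewrite /y (big_rem p) /=; last by rewrite mem_index_iota prime_gt0.
rewrite ifT ?dvdn_mulr //; apply/negP => /eqP p0.
by move: p0; rewrite p3.
Qed.

(** Descent: if [p] divides the norm it divides both coordinates, and dividing these by [p] lowers
    the valuation by 2. *)
Lemma inert3_logn_even (p : nat) (a b : int) : inert3 p ->
  a ^+ 2 - 3 * b ^+ 2 != 0 -> ~~ odd (logn p (absz (a ^+ 2 - 3 * b ^+ 2)%R)).
Proof.
move=> [pp pi]; have [m] := ubnP (`|a| + `|b|)%N.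
elim: m a b => // m IHm a b am nz.
case: (boolP (p %| a ^+ 2 - 3 * b ^+ 2)%Z) => pd; last first.
  by move: pd; rewrite dvdzE /= => pd; rewrite lognE (negbTE pd) !andbF.
have /andP[/dvdzP[a' aE] /dvdzP[b' bE]] := pi _ _ pd.
have E : a ^+ 2 - 3 * b ^+ 2 = p%:Z ^+ 2 * (a' ^+ 2 - 3 * b' ^+ 2).
  by rewrite aE bE; ring.
have nz' : a' ^+ 2 - 3 * b' ^+ 2 != 0 by move: nz; rewrite E mulf_eq0 negb_or => /andP[].
rewrite E abszM abszX absz_nat lognM ?expn_gt0 ?absz_gt0 ?prime_gt0 //.
rewrite pfactorK // oddD /=.
apply: IHm => //; apply: leq_trans (_ : `|a| + `|b| <= m)%N; last by [].
rewrite aE bE !abszM absz_nat -mulnDl ltn_Pmulr ?prime_gt1 // addn_gt0 !absz_gt0.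
by apply: contraNT nz'; rewrite negb_or !negbK => /andP[/eqP-> /eqP->].
Qed.

(** Irrationality of sqrt 3: the valuations at 3 of [a ^ 2] and [3 b ^ 2] have different
    parities. *)
Lemma norm3_eq0 (a b : int) : (a ^+ 2 - 3 * b ^+ 2 == 0) = (a == 0) && (b == 0).
Proof.
apply/idP/andP => [|[/eqP-> /eqP->] //].
rewrite subr_eq0 => /eqP ab.
case: (eqVneq b 0) ab => [->|b0 ab]; first by rewrite expr0n mulr0 => /eqP; rewrite sqrf_eq0.
have a0 : a != 0.
  apply/eqP => a0; move: ab; rewrite a0 expr0n /= => /esym/eqP.
  by rewrite mulf_eq0 sqrf_eq0 (negbTE b0).
have /(congr1 (fun z : int => odd (logn 3 (absz z)))) := ab.
by rewrite /= abszM !abszX lognM ?expn_gt0 ?absz_gt0 ?b0 // !lognX oddD !oddM.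
Qed.

(* The left-hand side has odd valuation at [p] unless it vanishes, the
   right-hand side an even one. *)
Lemma inert3_norm (p n : nat) (a b c d : int) : inert3 p -> ~~ (p %| n)%N ->
  p%:Z * (c ^+ 2 - 3 * d ^+ 2) = n%:Z * (a ^+ 2 - 3 * b ^+ 2) ->
  (c == 0) && (d == 0).
Proof.
move=> pi pn E; rewrite -norm3_eq0; apply/negPn/negP => nz.
have [pp p0] := (pi.1, prime_gt0 pi.1).
have n0 : (0 < n)%N by case: n pn {E} => //; rewrite dvdn0.
have nz' : a ^+ 2 - 3 * b ^+ 2 != 0.
  apply: contraNneq nz => nz; move: E; rewrite nz mulr0 => /eqP.
  by rewrite mulf_eq0 => /orP[|//]; rewrite eqz_nat; case: (p) pp.
have /(congr1 (fun z : int => odd (logn p (absz z)))) := E.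
rewrite /= !abszM !absz_nat !lognM ?absz_gt0 // !oddD.
rewrite (negbTE (inert3_logn_even pi nz)) (negbTE (inert3_logn_even pi nz')).
by rewrite (logn_prime _ pp) eqxx lognE (negbTE pn) !andbF.
Qed.

Lemma exists_pell3 (m : nat) : (0 < m)%N ->
  exists a b : int, [/\ 0 < a, 0 < b & a ^+ 2 - 3 * (m%:Z * b) ^+ 2 = 1].
Proof.
move=> m0.
(* [f n] holds the coordinates of [(2 + sqrt 3) ^ n]; the quotient of two of
   these powers that agree modulo [m] is the required unit. *)
pose f := fix f n : int * int := if n is n'.+1 then
  let: (a, b) := f n' in (2 * a + 3 * b, a + 2 * b) else (1, 0).
have fN n : (f n).1 ^+ 2 - 3 * (f n).2 ^+ 2 = 1.
  elim: n => //= n; case: (f n) => a b /= h; rewrite -[RHS]h; ring.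
have f0 n : 0 < (f n).1 /\ 0 <= (f n).2.
  elim: n => //= n; case: (f n) => a b /=; lia.
have f2 i j : (i < j)%N -> (f i).2 < (f j).2.
  elim: j => // j IH; rewrite ltnS leq_eqVlt => /orP[/eqP->|/IH {}IH] /=.
    by have := f0 j; case: (f j) => a b /=; lia.
  by have := f0 j; move: IH; case: (f j) => a b /=; lia.
pose g (i : 'I_(m * m).+1) : 'I_m * 'I_m :=
  (Ordinal (ltn_pmod (absz (f i).1) m0), Ordinal (ltn_pmod (absz (f i).2) m0)).
have /injectivePn[i [j ij [E1 E2]]] : ~~ injectiveb g.
  by apply/injectiveP => /leq_card; rewrite card_prod !card_ord ltnn.
wlog lij : i j ij E1 E2 / (i < j)%N.
  case: (ltngtP i j) => [lij|lij|/val_inj ijE] H; first exact: (H i j).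
    by apply: (H j i) => //; rewrite eq_sym.
  by rewrite ijE eqxx in ij.
move: (fN i) (fN j) (f0 i) (f0 j) (f2 _ _ lij) E1 E2.
case: (f i) (f j) => [a b] [a' b'] /= N N' [a0 b0] [a'0 b'0] bb' E1 E2.
have cong (x y : int) : 0 <= x -> 0 <= y -> (absz x %% m = absz y %% m)%N -> exists u, y = x + m%:Z * u.
  case: x y => [x|x] [y|y] // _ _ /= xy.
  exists ((y %/ m)%N%:Z - (x %/ m)%N%:Z).
  have := divn_eq x m; have := divn_eq y m; rewrite xy.
  by move: (x %/ m)%N (y %/ m)%N (y %% m)%N => q q' r -> ->; rewrite !PoszD !PoszM; ring.
have [u uE] := cong _ _ (ltW a0) (ltW a'0) E1.
have [v vE] := cong _ _ b0 b'0 E2.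
(* This is the sqrt 3 coordinate of the quotient of the two powers. *)
have H0 : b' * a - a' * b = m%:Z * (v * a - u * b). rewrite uE vE. ring.
have H : (a' * a - 3 * b' * b) ^+ 2 - 3 * (m%:Z * (v * a - u * b)) ^+ 2 = 1.
  rewrite -H0; transitivity ((a ^+ 2 - 3 * b ^+ 2) * (a' ^+ 2 - 3 * b' ^+ 2)); first by ring.
  by rewrite N N' mulr1.
exists `|a' * a - 3 * b' * b|, `|v * a - u * b|; split.
- rewrite normr_gt0; apply: contra_eq_neq H => ->.
  by have := sqr_ge0 (m%:Z * (v * a - u * b)); lia.
- rewrite normr_gt0; apply/eqP => E.
  have {}E : b' * a = a' * b by apply/eqP; rewrite -subr_eq0 H0 E mulr0.
  have : (b' * a) ^+ 2 - (a' * b) ^+ 2 = b' ^+ 2 * (a ^+ 2 - 3 * b ^+ 2) - b ^+ 2 * (a' ^+ 2 - 3 * b' ^+ 2) by ring.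
  rewrite E subrr N N' !mulr1 => /esym/eqP; rewrite subr_eq0 eqrXn2 //.
  by rewrite gt_eqF.
- by rewrite !exprMn !real_normK ?num_real // -exprMn.
Qed.

(** * Quaternion orders as matrices *)

(* [(a, b, c, d)] is [a + b i + c j + d i j] in the order [Z<i, j>] with
   [i ^ 2 = 3], [j ^ 2 = p] and [j i = - i j]. *)
Definition quat : Type := (int * int * int * int)%type.

Definition quat_mul (p : nat) (x y : quat) : quat :=
  let: (a, b, c, d) := x in let: (a', b', c', d') := y in
  (a * a' + 3 * b * b' + p%:Z * (c * c' - 3 * d * d'),
   a * b' + b * a' + p%:Z * (d * c' - c * d'),
   a * c' + c * a' + 3 * (b * d' - d * b'),
   a * d' + d * a' + b * c' - c * b').

Definition quat_conj (x : quat) : quat := let: (a, b, c, d) := x in (a, - b, - c, - d).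
Definition quat_opp (x : quat) : quat := let: (a, b, c, d) := x in (- a, - b, - c, - d).

Definition quat_norm (p : nat) (x : quat) : int :=
  let: (a, b, c, d) := x in a ^+ 2 - 3 * b ^+ 2 - p%:Z * (c ^+ 2 - 3 * d ^+ 2).

Lemma quat_normM p x y : quat_norm p (quat_mul p x y) = quat_norm p x * quat_norm p y.
Proof. case: x y => [[[a b] c] d] [[[a' b'] c'] d']; rewrite /quat_norm /=; ring. Qed.

Lemma quat_norm_conj p x : quat_norm p (quat_conj x) = quat_norm p x.
Proof. case: x => [[[a b] c] d]; rewrite /quat_norm /=; ring. Qed.

(** This makes the algebra a division algebra: a nontrivial zero would equate [p] times a norm from
    Q(sqrt 3) with a norm, against the parity of valuations. *)
Lemma inert3_quat_norm p x : inert3 p -> (quat_norm p x == 0) = (x == (0, 0, 0, 0)).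
Proof.
move=> pi; case: x => [[[a b] c] d]; apply/eqP/eqP => [|[-> -> -> ->]]; last by rewrite /=; ring.
move=> /= /eqP; rewrite subr_eq0 eq_sym => /eqP E.
have := @inert3_norm p 1 a b c d pi; rewrite Euclid_dvd1 ?pi.1 // mul1r => /(_ isT E).
move=> /andP[/eqP c0 /eqP d0]; have /eqP : a ^+ 2 - 3 * b ^+ 2 = 0 by rewrite -E c0 d0; ring.
by rewrite norm3_eq0 => /andP[/eqP-> /eqP->]; rewrite c0 d0.
Qed.

Definition mx2 (R : nzRingType) (a b c d : R) : 'M[R]_2 :=
  \matrix_(i < 2, j < 2) if i == 0 then if j == 0 then a else b else if j == 0 then c else d.

Lemma mx2_eta (R : nzRingType) (A : 'M[R]_2) : A = mx2 (A 0 0) (A 0 1) (A 1 0) (A 1 1).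
Proof.
apply/matrixP => i j; rewrite mxE.
by case: (unliftP 0 i) => [i'|] ->; case: (unliftP 0 j) => [j'|] -> //=;
  rewrite ?(ord1 i') ?(ord1 j'); congr (A _ _); apply/val_inj.
Qed.

Lemma mx2M (R : nzRingType) (a b c d a' b' c' d' : R) :
  mx2 a b c d *m mx2 a' b' c' d' =
  mx2 (a * a' + b * c') (a * b' + b * d') (c * a' + d * c') (c * b' + d * d').
Proof.
apply/matrixP => i j; rewrite !mxE !big_ord_recl big_ord0 !mxE /= addr0.
by case: ifP; case: ifP.
Qed.

Section QuatMatrix.
Variable R : realType.
Implicit Types (p : nat) (x y : quat).

Definition s3 : R := Num.sqrt 3.

Lemma s3_sqr : s3 * s3 = 3. Proof. by rewrite -expr2 sqr_sqrtr. Qed.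
Lemma s3_gt0 : 0 < s3. Proof. by rewrite sqrtr_gt0. Qed.
Lemma s3_lt2 : s3 < 2. Proof. by have := s3_sqr; have := s3_gt0; nra. Qed.
Lemma s3_gt1 : 1 < s3. Proof. by have := s3_sqr; have := s3_gt0; nra. Qed.

(** The splitting over Q(sqrt 3) that sends i to diag(sqrt 3, - sqrt 3) and j to the matrix with
    rows (0, p) and (1, 0). *)
Definition quat_mx (p : nat) (x : quat) : 'M[R]_2 := let: (a, b, c, d) := x in
  mx2 (a%:~R + b%:~R * s3) (p%:R * (c%:~R + d%:~R * s3)) (c%:~R - d%:~R * s3) (a%:~R - b%:~R * s3).

Lemma quat_mxM p x y : quat_mx p (quat_mul p x y) = quat_mx p x *m quat_mx p y.
Proof.
case: x y => [[[a b] c] d] [[[a' b'] c'] d']; rewrite /quat_mx mx2M /=.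
rewrite !(rmorphB, rmorphD, rmorphM) /=.
have h := s3_sqr.
by congr mx2; ring: h.
Qed.

Lemma det_mx22 (a b c d : R) : \det (mx2 a b c d) = a * d - b * c.
Proof. by rewrite det_mx2 !mxE. Qed.

Lemma det_quat_mx p x : \det (quat_mx p x) = (quat_norm p x)%:~R.
Proof.
case: x => [[[a b] c] d]; rewrite /quat_mx det_mx22 /=.
rewrite !(rmorphB, rmorphD, rmorphM, rmorphXn) /=.
have h := s3_sqr; ring: h.
Qed.

Lemma tr_quat_mx p x : \tr (quat_mx p x) = (x.1.1.1 * 2)%:~R.
Proof.
case: x => [[[a b] c] d]; rewrite /quat_mx /mxtrace !big_ord_recl big_ord0 !mxE /= rmorphM /=.
ring.
Qed.

Lemma quat_mx1 p : quat_mx p (1, 0, 0, 0) = 1%:M.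
Proof. by rewrite [RHS]mx2_eta !mxE /=; congr mx2; ring. Qed.

Lemma quat_mx_opp p x : quat_mx p (quat_opp x) = - quat_mx p x.
Proof.
case: x => [[[a b] c] d]; rewrite [RHS]mx2_eta !mxE /= !rmorphN /=.
by congr mx2; ring.
Qed.

Lemma quat_mxZ p (n : int) (x : quat) : quat_mx p (let: (a, b, c, d) := x in (n * a, n * b, n * c, n * d)) =
  n%:~R *: quat_mx p x.
Proof.
case: x => [[[a b] c] d]; rewrite [RHS]mx2_eta !mxE /= !rmorphM /=.
by congr mx2; ring.
Qed.

Lemma quat_mx_commutator p (a b c d a' b' c' d' : int) :
  quat_mx p (a, b, c, d) *m quat_mx p (a', b', c', d') - quat_mx p (a', b', c', d') *m quat_mx p (a, b, c, d) =
  quat_mx p (0, 2 * p%:Z * (d * c' - c * d'), 6 * (b * d' - d * b'), 2 * (b * c' - c * b')).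
Proof.
rewrite -!quat_mxM [LHS]mx2_eta !mxE /= !(rmorphB, rmorphD, rmorphM) /=.
by congr mx2; ring.
Qed.

(** Up to the factor [p], half sums and half differences of entries give [a], [c] and sqrt 3 times
    [b], [d]; the factors [p] and sqrt 3 are at least 1. *)
Lemma quat_mx_coef_lt p (a b c d M : R) : (0 < p)%N ->
  (forall i j, `|mx2 (a + b * s3) (p%:R * (c + d * s3)) (c - d * s3) (a - b * s3) i j| < M) ->
  [/\ `|a| < M, `|b| < M, `|c| < M & `|d| < M].
Proof.
move=> p0 H; have p1 : (1 : R) <= p%:R by rewrite ler1n.
have drop (r u : R) : 1 <= r -> `|r * u| < M -> `|u| < M.
  move=> r1; apply: le_lt_trans; rewrite normrM ler_peMl // ger0_norm //; lra.
move: (H 0 0) (H 0 1) (H 1 0) (H 1 1); rewrite !mxE /= => h1 /(drop _ _ p1) h2 h3 h4.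
move: h1 h2 h3 h4; rewrite !ltr_norml => /andP[? ?] /andP[? ?] /andP[? ?] /andP[? ?].
split; rewrite -?ltr_norml; try (rewrite ltr_norml; lra);
  apply: (drop s3); rewrite ?ltr_norml ?(ltW s3_gt1) //; lra.
Qed.

(** Discreteness of the order: integers at distance less than 1 are equal. *)
Lemma quat_mx_inj_lt1 p x y : (0 < p)%N ->
  (forall i j, `|quat_mx p x i j - quat_mx p y i j| < 1) -> x = y.
Proof.
move=> p0; case: x y => [[[a b] c] d] [[[a' b'] c'] d'] H.
have ieq (u v : int) : `|u%:~R - v%:~R : R| < 1 -> u = v.
  rewrite -rmorphB /= -intr_norm -[1]/(1%:~R) ltr_int; lia.
have [|h1 h2 h3 h4] := @quat_mx_coef_lt p (a%:~R - a'%:~R) (b%:~R - b'%:~R) (c%:~R - c'%:~R) (d%:~R - d'%:~R) 1 p0.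
  move=> i j; have := H i j; rewrite !mxE; apply: le_lt_trans.
  by rewrite le_eqVlt; apply/orP; left; apply/eqP; congr `|_|; do 2 case: ifP => _; ring.
by rewrite (ieq _ _ h1) (ieq _ _ h2) (ieq _ _ h3) (ieq _ _ h4).
Qed.

Lemma quat_mx_inj p : (0 < p)%N -> injective (quat_mx p).
Proof. by move=> p0 x y xy; apply: (quat_mx_inj_lt1 p0) => i j; rewrite xy subrr normr0. Qed.

End QuatMatrix.

(** * The norm-one groups *)

Section QuatGroup.
Variables (R : realType) (p : nat).
Implicit Types (A B : SL2 R) (x y : quat).

Lemma pi_PSL2V A : \pi_(PSL2 R) A^-1%g = (\pi_(PSL2 R) A)^-1%g.
Proof.
by apply: (mulgI (\pi_(PSL2 R) A)); rewrite -pi_PSL2M !mulgV.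
Qed.

Definition quat_SL2 : set (SL2 R) := [set A | exists x, SL2_mx A = quat_mx R p x].

Definition quat_PSL2 : set (PSL2 R) := [set \pi_(PSL2 R) A | A in quat_SL2].

Lemma quat_SL2P x : quat_norm p x = 1 -> exists2 A, quat_SL2 A & SL2_mx A = quat_mx R p x.
Proof.
move=> x1; have h : \det (quat_mx R p x) = 1 by rewrite det_quat_mx x1.
by exists (mkSL2 h); [exists x|]; rewrite mkSL2K.
Qed.

Lemma quat_SL2_norm A x : SL2_mx A = quat_mx R p x -> quat_norm p x = 1.
Proof.
move=> Ax; have := det_SL2 A; rewrite Ax det_quat_mx -[RHS]/(1%:~R) => /intr_inj; exact.
Qed.

Lemma quat_SL2_opp A : quat_SL2 (SL2_opp A) <-> quat_SL2 A.
Proof.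
have H B : quat_SL2 B -> quat_SL2 (SL2_opp B).
  by case=> x Bx; exists (quat_opp x); rewrite mkSL2K Bx quat_mx_opp.
by split; [move=> /H; rewrite SL2_oppK | exact: H].
Qed.

Lemma quat_PSL2_pi A : quat_PSL2 (\pi_(PSL2 R) A) <-> quat_SL2 A.
Proof.
split=> [|?]; last by exists A.
by case=> B GB /eq_PSL2 /orP[/eqP <-//|/eqP AE]; move: GB; rewrite AE quat_SL2_opp.
Qed.

Lemma SL2_mxV A : SL2_mx A^-1%g = mx2 (SL2_mx A 1 1) (- SL2_mx A 0 1) (- SL2_mx A 1 0) (SL2_mx A 0 0).
Proof.
have h : \det (mx2 (SL2_mx A 1 1) (- SL2_mx A 0 1) (- SL2_mx A 1 0) (SL2_mx A 0 0)) = 1.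
  by rewrite -(det_SL2 A) det_mx2 det_mx22; ring.
suff -> : A^-1%g = mkSL2 h by rewrite mkSL2K.
apply: (mulgI A); rewrite mulgV; apply: SL2_mx_inj.
rewrite SL2_mxM !mkSL2K [X in X *m _]mx2_eta mx2M [LHS]mx2_eta !mxE /=.
have := det_SL2 A; rewrite det_mx2 => hd.
by congr mx2; rewrite -?[LHS]hd; ring.
Qed.

Lemma quat_SL2V A x : SL2_mx A = quat_mx R p x -> SL2_mx A^-1%g = quat_mx R p (quat_conj x).
Proof.
rewrite SL2_mxV => ->; case: x => [[[a b] c] d]; rewrite !mxE /= !rmorphN /=.
by congr mx2; ring.
Qed.

Lemma group_quat_PSL2 : group_closed (mem quat_PSL2).
Proof.
split.
  rewrite inE; exists 1%g => //; exists (1, 0, 0, 0).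
  by rewrite quat_mx1 mkSL2K.
move=> g h; rewrite !inE => -[A [x Ax] <-] [B [y By] <-].
rewrite -pi_PSL2V -pi_PSL2M; exists (A * B^-1)%g => //.
exists (quat_mul p x (quat_conj y)).
by rewrite quat_mxM SL2_mxM Ax (quat_SL2V By).
Qed.

Lemma isolated_quat_PSL2 : (0 < p)%N -> quat_PSL2 `<=` isolated quat_PSL2.
Proof.
move=> p0 g [A [x Ax] <-]; split; first by rewrite inE; exists A => //; exists x.
pose V (M : 'M[R]_2) : set (SL2 R) := [set B | forall i j, `|M i j - SL2_mx B i j| < 1].
have openV M : open (V M).
  have -> : V M = set_val @^-1` ball M 1.
    by apply/seteqP; split=> B => [VB|[]].
  exists (ball M 1) => //; exact: ball_open.
pose W : set (PSL2 R) := [set \pi_(PSL2 R) B | B in V (SL2_mx A)].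
exists W.
  apply: open_nbhs_nbhs; split; last first.
    by exists A => // i j; rewrite subrr normr0.
  rewrite /open /= /quotient_open.
  (* A set is open in the quotient when its preimage is; saturating the unit ball at [A] only adds
     the one at [- A]. *)
  have -> : \pi_(PSL2 R) @^-1` W = V (SL2_mx A) `|` V (- SL2_mx A).
    apply/seteqP; split=> [B [C VC /eq_PSL2 /orP[/eqP<-|/eqP CE]]|B [VB|VB]].
    - by left.
    - right=> i j; have := VC i j; rewrite CE mkSL2K !mxE opprK -normrN.
      by rewrite opprD.
    - by exists B.
    - exists (SL2_opp B); last by apply/eq_PSL2; rewrite /pm_eq eqxx orbT.
      move=> i j; rewrite mkSL2K mxE opprK -normrN opprD.
      by have := VB i j; rewrite mxE.
  exact: openU.
apply/seteqP; split=> [h [[B VB <-]] | h ->]; last first.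
  split; first by exists A => // i j; rewrite subrr normr0.
  by exists A => //; exists x.
rewrite quat_PSL2_pi => -[y By]; congr (\pi_(PSL2 R) _).
apply: SL2_mx_inj; rewrite Ax By; congr quat_mx.
apply: (@quat_mx_inj_lt1 R p y x p0) => i j; rewrite distrC -Ax -By; exact: VB.
Qed.

Lemma quat_PSL2_over (K : fieldExtType rat) (iota : {rmorphism K -> R}) (sqrt3 : K) :
  sqrt3 ^+ 2 = 3 -> quat_PSL2 `<=` PSL2_over iota.
Proof.
move=> h3 _ [A [x Ax] <-]; exists A => //.
(* The embedding may send [sqrt3] to the negative root; [r] corrects the sign. *)
have [r rE] : exists r, iota r = s3 R.
  have /eqP : (iota sqrt3) ^+ 2 = s3 R ^+ 2.
    by rewrite -rmorphXn h3 rmorph_nat expr2 s3_sqr.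
  rewrite eqf_sqr => /orP[/eqP<-|/eqP E]; first by exists sqrt3.
  by exists (- sqrt3); rewrite rmorphN E opprK.
rewrite /= Ax; case: x {Ax} => [[[a b] c] d].
exists (mx2 (a%:~R + b%:~R * r) (p%:R * (c%:~R + d%:~R * r)) (c%:~R - d%:~R * r) (a%:~R - b%:~R * r)).
rewrite [RHS]mx2_eta !mxE /= -rE.
by rewrite !(rmorphB, rmorphD, rmorphM, rmorph_int, rmorph_nat).
Qed.

Lemma traces_quat_PSL2 t : traces quat_PSL2 t -> exists a : int, t = a%:~R :> R.
Proof.
by case=> A /= /quat_PSL2_pi[x Ax] <-; rewrite Ax tr_quat_mx; eexists.
Qed.

End QuatGroup.
Arguments quat_SL2 : clear implicits.
Arguments quat_PSL2 : clear implicits.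

(** * The invariant trace field is Q *)

Section TraceField.
Variables (R : realType) (p : nat).

Lemma fuchsian_quat_PSL2 : (0 < p)%N -> fuchsian (quat_PSL2 R p).
Proof.
by move=> p0; split; [exact: group_quat_PSL2 | exact: isolated_quat_PSL2].
Qed.

Lemma algebraic_integer_quat_PSL2 : traces (quat_PSL2 R p) `<=` @algebraic_integer R.
Proof. by move=> t /traces_quat_PSL2[a ->]; exact: integral_id. Qed.

Lemma square_subgroup_sub (G : set (PSL2 R)) : group_closed (mem G) -> square_subgroup G `<=` G.
Proof.
move=> GG; apply: smallest_sub => // _ [g Gg <-]; have := group_closedM GG.
by move=> /(_ g g); rewrite !inE -expg2 => /(_ Gg Gg).
Qed.

Lemma invariant_trace_field_quat_PSL2 :
  invariant_trace_field (quat_PSL2 R p) = range (ratr : rat -> R).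
Proof.
apply/seteqP; split.
  apply: smallest_sub.
    split; rewrite ?inE; first by exists 1; rewrite ?rmorph1.
      by move=> x y; rewrite !inE => -[a _ <-] [b _ <-]; exists (a - b); rewrite ?rmorphB.
    by move=> x y; rewrite !inE => -[a _ <-] [b _ <-]; exists (a / b); rewrite ?fmorph_div.
  move=> t [A /= /(square_subgroup_sub (group_quat_PSL2 R p)) GA <-].
  have [|a ->] := @traces_quat_PSL2 R p (\tr (SL2_mx A)); first by exists A.
  by exists a%:~R; rewrite ?ratr_int.
move=> _ [x _ <-] M [/= [M1 MB MV] _].
have M0 : (0 : R) \in mem M by rewrite -(subrr 1) MB.
have MN z : z \in mem M -> - z \in mem M by move=> Mz; rewrite -sub0r MB.
have Mnat (n : nat) : n%:R \in mem M.
  by elim: n => [//|n IH]; have := MB _ _ IH (MN _ M1); rewrite opprK natr1.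
have Mint (n : int) : n%:~R \in mem M.
  by case: n => n; rewrite ?NegzE ?mulrNz ?MN //; exact: Mnat.
by apply/set_mem; rewrite /ratr MV.
Qed.

(** The only ring morphism from [rat] to [R[i]] is [ratr], whose values are real. *)
Lemma totally_real_range_rat : totally_real_number_field (range (ratr : rat -> R)).
Proof.
exists (rat^o : fieldExtType rat), (ratr : {rmorphism rat -> R}); split=> // s x.
have -> : s x = (ratr (x : rat))%:C%C.
  by rewrite fmorph_rat; exact: (fmorph_eq_rat (s : {rmorphism rat -> R[i]})).
by [].
Qed.

End TraceField.

(** * Reduction to a compact box *)

Section Reduction.
Variable R : realType.
Implicit Types (x y : R) (p : nat).

(** The integer parts of [f - a] and [g - b] sort the points into [L * L] unit squares. *)
Lemma pigeonhole_box (T : finType) (f g : T -> R) (a b : R) (L : nat) :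
  (forall t, a <= f t < a + L%:R) -> (forall t, b <= g t < b + L%:R) ->
  (L * L < #|T|)%N ->
  exists t t', [/\ t != t', `|f t - f t'| < 1 & `|g t - g t'| < 1].
Proof.
move=> fL gL LT.
have bnd (h : T -> R) c t : (forall t, c <= h t < c + L%:R) -> (Num.truncn (h t - c) < L)%N.
  move=> /(_ t) /andP[h1 h2]; rewrite truncn_lt_nat ?subr_ge0 //; lra.
have close (h : T -> R) c t t' : (forall t, c <= h t < c + L%:R) ->
    Num.truncn (h t - c) = Num.truncn (h t' - c) -> `|h t - h t'| < 1.
  move=> hL E; rewrite ltr_norml.
  have /andP[c1 c2] : ((Num.truncn (h t - c))%:R <= h t - c < (Num.truncn (h t - c)).+1%:R).
    by apply: truncn_itv; have := hL t; lra.
  have /andP[d1 d2] : ((Num.truncn (h t' - c))%:R <= h t' - c < (Num.truncn (h t' - c)).+1%:R).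
    by apply: truncn_itv; have := hL t'; lra.
  rewrite -natr1 -E in c1 c2 d1 d2; rewrite -natr1 in d2; lra.
pose F t : 'I_L * 'I_L := (Ordinal (bnd f a t fL), Ordinal (bnd g b t gL)).
have /injectivePn[t [t' tt' [E1 E2]]] : ~~ injectiveb F.
  by apply/injectiveP => /leq_card; rewrite card_prod !card_ord leqNgt LT.
by exists t, t'; split=> //; [exact: close E1|exact: close E2].
Qed.

(** Dirichlet approximation by differences of points of the order. The bounds do not depend on [x],
    which makes the final box uniform. *)
Lemma exists_small_quat p x : (0 < p)%N -> exists q : quat, q <> (0, 0, 0, 0) /\
  let A := quat_mx R p q in
  [/\ `|A 0 0| < (8 * p)%:R, `|A 1 0| < (8 * p)%:R,
      `|A 0 0 * x + A 0 1| < 1 & `|A 1 0 * x + A 1 1| < 1].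
Proof.
move=> p0; pose k := (8 * p)%N.
pose X := (Num.truncn `|x|).+1.
have xX : `|x| < X%:R by rewrite truncnS_gt.
(* [M] exceeds [k X], a bound for [u x] and [v x], so that [f] and [g] take values in intervals of
   length [L = 6 p M]. As [k = 8 p], the [(k M) ^ 2] quadruples outnumber the [L ^ 2] unit
   squares. *)
pose M := (k * X + k + 1)%N; pose s := s3 R.
(* [b] and [d] take [M] values and [a], [c] then [k] values each, so that [u] and
   [v] stay bounded independently of [M]. *)
pose T := ('I_M * 'I_M * 'I_k * 'I_k)%type.
pose b (t : T) : int := t.1.1.1; pose d (t : T) : int := t.1.1.2.
pose a (t : T) : int := (t.1.2)%:Z - Num.floor ((b t)%:~R * s).
pose c (t : T) : int := (t.2)%:Z + Num.floor ((d t)%:~R * s).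
pose u t : R := (a t)%:~R + (b t)%:~R * s.
pose v t : R := (c t)%:~R - (d t)%:~R * s.
have s0 : 0 < s := s3_gt0 R.
have s2 : s < 2 := s3_lt2 R.
have fl (z : R) : (Num.floor z)%:~R <= z < (Num.floor z)%:~R + 1.
  by rewrite floor_le_tmp /= -[1]/(1%:~R) -rmorphD floorD1_gt.
have ord_lt n (i : 'I_n) : (i%:R : R) <= n%:R - 1.
  by rewrite lerBrDr natr1 ler_nat ltn_ord.
have u_itv t : 0 <= u t < k%:R.
  rewrite /u /a rmorphB /=; have := fl ((b t)%:~R * s).
  have := ord_lt _ t.1.2; have : (0 : R) <= (t.1.2)%:R by [].
  rewrite -[(t.1.2)%:~R]/((t.1.2)%:R); lra.
have v_itv t : - 1 < v t <= k%:R - 1.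
  rewrite /v /c rmorphD /=; have := fl ((d t)%:~R * s).
  have := ord_lt _ t.2; have : (0 : R) <= (t.2)%:R by [].
  rewrite -[(t.2)%:~R]/((t.2)%:R); lra.
have b_itv t : 0 <= (b t)%:~R * s <= 2 * M%:R.
  rewrite mulr_ge0 ?ler0z ?(ltW s0) //= mulrC ler_pM ?(ltW s0) ?ler0z // ?(ltW s2) //.
  by rewrite -[(b t)%:~R]/((t.1.1.1)%:R) ler_nat ltnW.
have d_itv t : 0 <= (d t)%:~R * s <= 2 * M%:R.
  rewrite mulr_ge0 ?ler0z ?(ltW s0) //= mulrC ler_pM ?(ltW s0) ?ler0z // ?(ltW s2) //.
  by rewrite -[(d t)%:~R]/((t.1.1.2)%:R) ler_nat ltnW.
pose P : R := p%:R; have P1 : 1 <= P by rewrite ler1n.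
have kP : k%:R = 8 * P by rewrite natrM.
have ME : M%:R = k%:R * X%:R + k%:R + 1 :> R by rewrite /M natrD [in LHS]natrD [in LHS]natrM.
have ux t : - (k%:R * X%:R) <= u t * x <= k%:R * X%:R.
  rewrite -ler_norml normrM ler_pM // ?(ltW xX) //.
  by rewrite ger0_norm; have := u_itv t; lra.
have vx t : - (k%:R * X%:R) <= v t * x <= k%:R * X%:R.
  rewrite -ler_norml normrM ler_pM // ?(ltW xX) //.
  by rewrite ler_norml; have := v_itv t; lra.
pose f t := u t * x + P * ((c t)%:~R + (d t)%:~R * s).
pose g t := v t * x + ((a t)%:~R - (b t)%:~R * s).
pose L := (6 * p * M)%N.
have LE : L%:R = 6 * P * M%:R by rewrite !natrM.
have M0 : (0 : R) <= M%:R by [].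
have KX0 : (0 : R) <= k%:R * X%:R by rewrite mulr_ge0 ?ler0n.
have [t [t' [tt' hf hg]]] : exists t t', [/\ t != t', `|f t - f t'| < 1 & `|g t - g t'| < 1].
  apply: (@pigeonhole_box _ f g (- (k%:R * X%:R) - P) (- (k%:R * X%:R) - 4 * M%:R) L).
  - move=> t; rewrite /f LE.
    have -> : (c t)%:~R + (d t)%:~R * s = v t + 2 * ((d t)%:~R * s) by rewrite /v; ring.
    have := ux t; have /andP[h1 h2] := v_itv t; have /andP[h3 h4] := d_itv t.
    set w := v t + _; have w1 : -1 <= w by rewrite /w; lra.
    have w2 : w <= k%:R - 1 + 4 * M%:R by rewrite /w; lra.
    have : - P <= P * w by rewrite -mulrN1 ler_pM2l; lra.
    have : P * w <= P * (k%:R - 1 + 4 * M%:R) by rewrite ler_pM2l; lra.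
    have : 0 <= (P - 1) * (k%:R * X%:R) by rewrite mulr_ge0 // subr_ge0.
    rewrite ME kP; nra.
  - move=> t; rewrite /g LE.
    have -> : (a t)%:~R - (b t)%:~R * s = u t - 2 * ((b t)%:~R * s) by rewrite /u; ring.
    have := vx t; have /andP[h1 h2] := u_itv t; have /andP[h3 h4] := b_itv t.
    have : 0 <= (P - 1) * M%:R by rewrite mulr_ge0 // subr_ge0.
    rewrite ME kP; nra.
  - rewrite !card_prod !card_ord /L /k.
    have : (0 < p * M)%N by rewrite muln_gt0 p0 /M addn1.
    move: (M) => m; nia.
exists (a t - a t', b t - b t', c t - c t', d t - d t'); split.
  (* Once [b] and [d] agree, so do the floors in [a] and [c], hence the remaining two coordinates of
     [t] and [t']. *)
  move=> [] /eqP + /eqP + /eqP + /eqP; rewrite !subr_eq0.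
  move=> /eqP ea /eqP eb /eqP ec /eqP ed; move/negP: tt'; apply; apply/eqP.
  move: ea ec; rewrite /a /c eb ed => /addIr em /addIr en.
  move: em en eb ed; rewrite /b /d; case: (t) (t') => [[[? ?] ?] ?] [[[? ?] ?] ?] /=.
  by move=> [] /val_inj -> [] /val_inj -> [] /val_inj -> [] /val_inj ->.
have iB (m n : int) : (m - n)%:~R = m%:~R - n%:~R :> R by rewrite rmorphB.
rewrite /= !mxE /= (iB (a t)) (iB (b t)) (iB (c t)) (iB (d t)) -/s.
have hu := u_itv t; have hu' := u_itv t'; have hv := v_itv t; have hv' := v_itv t'.
split.
- have -> : (a t)%:~R - (a t')%:~R + ((b t)%:~R - (b t')%:~R) * s = u t - u t' by rewrite /u; ring.
  by rewrite ltr_norml -/k; lra.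
- have -> : (c t)%:~R - (c t')%:~R - ((d t)%:~R - (d t')%:~R) * s = v t - v t' by rewrite /v; ring.
  by rewrite ltr_norml -/k; lra.
- by move: hf; rewrite /f /u; congr (`|_| < _); rewrite /P; ring.
- by move: hg; rewrite /g /v; congr (`|_| < _); ring.
Qed.

End Reduction.

(** * The Moebius action in real coordinates *)

Section HalfPlaneAction.
Variable R : realType.
Local Notation H := (upper_half_plane R).
Implicit Types (A B : SL2 R) (z w : H).

Definition hp_re z : R := complex.Re (hp_val z).
Definition hp_im z : R := complex.Im (hp_val z).

Lemma hp_im_gt0 z : 0 < hp_im z. Proof. exact: hp_valP. Qed.

Lemma hp_ext z w : hp_re z = hp_re w -> hp_im z = hp_im w -> z = w.
Proof.
rewrite /hp_re /hp_im => hr hi; apply: val_inj; change (hp_val z = hp_val w).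
by case: (hp_val z) hr hi => a b; case: (hp_val w) => c d /= -> ->.
Qed.

Lemma hp_val_mkH (u : R[i]) (hu : 0 < complex.Im u) : hp_val (mkH hu) = u.
Proof. by rewrite /hp_val set_valE. Qed.

Lemma hp_val_act A z : hp_val (SL2_act A z) = homography (SL2_mx A) (hp_val z).
Proof. exact: hp_val_mkH. Qed.

(** With z = x + i y and rows (a, b), (c, d), [denom] is |c z + d|^2 and [numer_re] is the real part
    of a z + b times the conjugate of c z + d. *)
Definition denom (A : 'M[R]_2) (x y : R) : R := (A 1 0 * x + A 1 1) ^+ 2 + (A 1 0 * y) ^+ 2.
Definition numer_re (A : 'M[R]_2) (x y : R) : R :=
  (A 0 0 * x + A 0 1) * (A 1 0 * x + A 1 1) + A 0 0 * A 1 0 * y ^+ 2.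

Lemma denom_gt0 A x y : 0 < y -> 0 < denom (SL2_mx A) x y.
Proof.
move=> y0; rewrite lt_def addr_ge0 ?sqr_ge0 // andbT paddr_eq0 ?sqr_ge0 //.
rewrite !sqrf_eq0 mulf_eq0 (gt_eqF y0) orbF; apply/negP => /andP[+ /eqP c0].
rewrite c0 mul0r add0r => /eqP d0; have := det_SL2 A; rewrite det_mx2 c0 d0.
by rewrite !mulr0 subrr => /esym/eqP; rewrite oner_eq0.
Qed.

Lemma SL2_act_re A z :
  hp_re (SL2_act A z) = numer_re (SL2_mx A) (hp_re z) (hp_im z) / denom (SL2_mx A) (hp_re z) (hp_im z).
Proof.
have := denom_gt0 A (hp_re z) (hp_im_gt0 z).
rewrite /hp_re /hp_im /numer_re /denom hp_val_act /homography.
move: (SL2_mx A) (hp_val z) => {}A [x y] /=.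
move: (A 0 0) (A 0 1) (A 1 0) (A 1 1) => a b c d n0.
rewrite !mul0r !addr0 !subr0.
set n := (c * x + d) ^+ 2 + (c * y) ^+ 2.
rewrite -/n in n0 *.
have nz : n != 0 by rewrite gt_eqF.
by field.
Qed.

Lemma SL2_act_im A z :
  hp_im (SL2_act A z) = hp_im z / denom (SL2_mx A) (hp_re z) (hp_im z).
Proof.
have := denom_gt0 A (hp_re z) (hp_im_gt0 z).
have := det_SL2 A; rewrite det_mx2.
rewrite /hp_re /hp_im /denom hp_val_act /homography.
move: (SL2_mx A) (hp_val z) => {}A [x y] /=.
move: (A 0 0) (A 0 1) (A 1 0) (A 1 1) => a b c d adbc n0.
rewrite !mul0r !addr0 !subr0.
set n := (c * x + d) ^+ 2 + (c * y) ^+ 2.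
rewrite -/n in n0 *.
transitivity ((a * d - b * c) * y / n); last by rewrite adbc mul1r.
ring.
Qed.

Lemma denomC_neq0 A z : (SL2_mx A 1 0)%:C%C * hp_val z + (SL2_mx A 1 1)%:C%C != 0.
Proof.
have := denom_gt0 A (hp_re z) (hp_im_gt0 z).
rewrite /denom /hp_re /hp_im; case: (hp_val z) => x y /=.
move: (SL2_mx A 1 0) (SL2_mx A 1 1) => c d; apply: contraTneq => /eqP.
rewrite eq_complex /= !mul0r subr0 !addr0 => /andP[/eqP-> /eqP->].
by rewrite expr0n addr0 ltxx.
Qed.

Lemma SL2_actM A B z : SL2_act (A * B)%g z = SL2_act A (SL2_act B z).
Proof.
have nB := denomC_neq0 B z.
have nA := denomC_neq0 A (SL2_act B z).
apply: val_inj; change (hp_val (SL2_act (A * B)%g z) = hp_val (SL2_act A (SL2_act B z))).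
move: nA; rewrite !hp_val_act /homography SL2_mxM.
rewrite [SL2_mx A]mx2_eta [SL2_mx B]mx2_eta mx2M !mxE /= in nB *.
rewrite !(rmorphD, rmorphM) /=.
move: (SL2_mx A) (SL2_mx B) (hp_val z) nB => {}A {}B {}z nB nA.
set a0 := real_complex _ (B 0 0) in nA nB *.
set b0 := real_complex _ (B 0 1) in nA nB *.
set c0 := real_complex _ (B 1 0) in nA nB *.
set d0 := real_complex _ (B 1 1) in nA nB *.
set a := real_complex _ (A 0 0) in nA nB *.
set b := real_complex _ (A 0 1) in nA nB *.
set c := real_complex _ (A 1 0) in nA nB *.
set d := real_complex _ (A 1 1) in nA nB *.
have nA' : c * (a0 * z + b0) + d * (c0 * z + d0) != 0.
  have -> : c * (a0 * z + b0) + d * (c0 * z + d0) = (c * ((a0 * z + b0) / (c0 * z + d0)) + d) * (c0 * z + d0) by field.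
  by rewrite mulf_neq0.
by field; rewrite nB nA'.
Qed.

Lemma SL2_act1 z : SL2_act 1%g z = z.
Proof.
apply: hp_ext; rewrite ?(SL2_act_re, SL2_act_im) /numer_re /denom mkSL2K !mxE /=.
  by rewrite !mul0r !mulr0 !mul0r !mul1r !addr0 !add0r expr0n expr1n addr0 divr1 mulr1.
by rewrite !mul0r add0r expr0n expr1n addr0 divr1.
Qed.

End HalfPlaneAction.

(** * Hermite's reduction by the Hilbert-Schmidt form *)

Section ReductionBox.
Variable R : realType.
Local Notation H := (upper_half_plane R).
Implicit Types (A B : 'M[R]_2) (x y : R).

(* [y] times the squared Hilbert-Schmidt norm of [A *m g] for [g] in SL(2, R)
   with [g i = x + i y] *)
Definition hs_form A x y : R :=
  (A 0 0 * x + A 0 1) ^+ 2 + (A 0 0 * y) ^+ 2 + denom A x y.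

Definition mx_sqr_sum A : R := A 0 0 ^+ 2 + A 0 1 ^+ 2 + A 1 0 ^+ 2 + A 1 1 ^+ 2.

Lemma mulmx2E A B i j : (A *m B) i j = A i 0 * B 0 j + A i 1 * B 1 j.
Proof. by rewrite mxE !big_ord_recl big_ord0 addr0; congr (A _ _ * B _ _ + A _ _ * B _ _); apply/val_inj. Qed.

(** Submultiplicativity of the Hilbert-Schmidt norm: Cauchy-Schwarz for each row of [B]. *)
Lemma hs_form_mul A B x y : hs_form (B *m A) x y <= mx_sqr_sum B * hs_form A x y.
Proof.
have CS (a b u v : R) : (a * u + b * v) ^+ 2 <= (a ^+ 2 + b ^+ 2) * (u ^+ 2 + v ^+ 2).
  rewrite -subr_ge0; suff -> : (a ^+ 2 + b ^+ 2) * (u ^+ 2 + v ^+ 2) - (a * u + b * v) ^+ 2 = (a * v - b * u) ^+ 2.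
    exact: sqr_ge0.
  ring.
rewrite /hs_form /denom /mx_sqr_sum !mulmx2E.
move: (A 0 0) (A 0 1) (A 1 0) (A 1 1) (B 0 0) (B 0 1) (B 1 0) (B 1 1) => a b c d e f g h.
have := CS e f (a * x + b) (c * x + d); have := CS e f (a * y) (c * y).
have := CS g h (a * x + b) (c * x + d); have := CS g h (a * y) (c * y).
have -> : (e * a + f * c) * x + (e * b + f * d) = e * (a * x + b) + f * (c * x + d) by ring.
have -> : (g * a + h * c) * x + (g * b + h * d) = g * (a * x + b) + h * (c * x + d) by ring.
have -> : (e * a + f * c) * y = e * (a * y) + f * (c * y) by ring.
have -> : (g * a + h * c) * y = g * (a * y) + h * (c * y) by ring.
move=> h1 h2 h3 h4; apply: le_trans (lerD (lerD h4 h3) (lerD h2 h1)) _.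
by rewrite le_eqVlt; apply/orP; left; apply/eqP; ring.
Qed.

(** Both sides are the squared modulus of a z + b times the conjugate of c z + d, whose imaginary
    part is [\det A * y]. *)
Lemma hs_form_det A x y :
  ((A 0 0 * x + A 0 1) ^+ 2 + (A 0 0 * y) ^+ 2) * denom A x y = numer_re A x y ^+ 2 + (\det A * y) ^+ 2.
Proof. by rewrite /denom /numer_re det_mx2; ring. Qed.

(** The arithmetic-geometric mean inequality applied to the two factors in [hs_form_det]. *)
Lemma det_le_hs_form A x y : 1 <= y -> `|\det A| <= hs_form A x y.
Proof.
move=> y1; have := hs_form_det A x y; rewrite /hs_form.
have D0 : 0 <= denom A x y by rewrite addr_ge0 // sqr_ge0.
set N := _ + _; have N0 : 0 <= N by rewrite addr_ge0 // sqr_ge0.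
move: (denom _ _ _) D0 => D D0 E.
have h : `|\det A| <= `|\det A * y|.
  by rewrite normrM ler_peMr // ger0_norm //; lra.
apply: le_trans h _; rewrite -ler_sqr ?nnegrE ?(addr_ge0 N0 D0) // real_normK ?num_real //.
have := sqr_ge0 (numer_re A x y); have := sqr_ge0 (N - D); nra.
Qed.

Definition box (C : R) : set H :=
  [set z | [/\ `|hp_re z| <= C, C^-1 <= hp_im z & hp_im z <= C]].

(** Let N = |a z + b|^2 and D = |c z + d|^2. Then N D is at least y^2, hence at least 1, so N <= C
    forces D >= 1 / C; with D <= C this bounds both coordinates of the image. *)
Lemma hs_form_box (A : SL2 R) (z : H) (C : R) :
  1 <= hp_im z -> hs_form (SL2_mx A) (hp_re z) (hp_im z) <= C -> box C (SL2_act A z).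
Proof.
rewrite /box /= SL2_act_re SL2_act_im.
have := denom_gt0 A (hp_re z) (hp_im_gt0 z).
have := hs_form_det (SL2_mx A) (hp_re z) (hp_im z).
rewrite det_SL2 mul1r /hs_form.
move: (hp_re z) (hp_im z) => x y.
set N := _ + _; have N0 : 0 <= N by rewrite addr_ge0 // sqr_ge0.
move: (denom _ _ _) (numer_re _ _ _) => D r E D0 y1 NDC.
have C0 : 0 < C by lra.
have yy : 1 <= y ^+ 2 by rewrite expr_ge1 //; lra.
have ND : y ^+ 2 <= N * D by rewrite E lerDr sqr_ge0.
have CD : 1 <= C * D by nra.
split.
- rewrite -ler_sqr ?nnegrE ?(ltW C0) // real_normK ?num_real // expr_div_n.
  rewrite ler_pdivrMr ?exprn_gt0 // -exprMn.
  have : r ^+ 2 <= N * D by rewrite E lerDl sqr_ge0.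
  have : N * D <= C * D by rewrite ler_pM2r //; lra.
  have : C * D <= (C * D) ^+ 2 by rewrite expr2; nra.
  lra.
- rewrite ler_pdivlMr // ler_pdivrMl //; nra.
- rewrite ler_pdivrMr //.
  have : y ^+ 2 <= C * D by apply: le_trans ND _; rewrite ler_pM2r //; lra.
  rewrite expr2; nra.
Qed.

(** A unit a + b sqrt 3 of norm one acts as the scaling by its square. For 2 + sqrt 3 the ratio [w]
    is at most 16, so some power brings any height into [1, 16]. *)
Lemma exists_scaled y : 0 < y -> exists a b : int,
  a ^+ 2 - 3 * b ^+ 2 = 1 /\ 1 <= (a%:~R + b%:~R * s3 R) ^+ 2 * y <= 16.
Proof.
move=> y0; pose s := s3 R; have ss : s * s = 3 := s3_sqr R.
have s0 : 1 < s := s3_gt1 R. have s2 : s < 2 := s3_lt2 R.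
pose w := (2 + s) ^+ 2.
have w2 : 2 <= w by rewrite /w; nra.
have w16 : w <= 16 by rewrite /w; nra.
have fP n : exists a b : int, [/\ a ^+ 2 - 3 * b ^+ 2 = 1,
    (a%:~R + b%:~R * s) ^+ 2 = w ^+ n & (a%:~R - b%:~R * s) ^+ 2 = w ^- n].
  have wV : (2 - s) ^+ 2 = w^-1.
    have w0 : w != 0 by rewrite gt_eqF //; lra.
    apply: (mulIf w0); rewrite mulVf // /w -exprMn.
    have -> : (2 - s) * (2 + s) = 1 by ring: ss.
    by rewrite expr1n.
  elim: n => [|n [a [b [ab E1 E2]]]].
    by exists 1, 0; split; rewrite ?expr0 ?invr1; ring.
  exists (2 * a + 3 * b), (a + 2 * b); split.
  - by rewrite -[RHS]ab; ring.
  - rewrite [in RHS]exprS -E1 /w -exprMn !(rmorphD, rmorphM) /=; congr (_ ^+ 2); ring: ss.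
  - rewrite [in RHS]exprS invfM -E2 -wV -exprMn !(rmorphD, rmorphM) /=; congr (_ ^+ 2); ring: ss.
have pow (u : R) : 1 <= u -> exists n, w ^+ n <= u < w ^+ n.+1.
  move=> u1.
  have /ex_minnP[n un nmin] : exists n, u < w ^+ n.+1.
    exists (Num.bound u); apply: lt_le_trans (_ : 2 ^+ (Num.bound u).+1 <= _).
      exact: upper_nthrootP.
    by rewrite lerXn2r // nnegrE; lra.
  exists n; rewrite un andbT; case: n {un} nmin => [|n] nmin; first by rewrite expr0.
  by rewrite leNgt; apply/negP => /nmin; rewrite ltnn.
case: (leP 1 y) => y1.
  have [n /andP[n1 n2]] := pow y y1; have [a [b [ab _ E]]] := fP n.
  (* The conjugate unit is the inverse and scales down by [w ^ n]. *)
  exists a, (- b); rewrite sqrrN rmorphN mulNr; split=> //; rewrite E.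
  have wn : 0 < w ^+ n by rewrite exprn_gt0 //; lra.
  rewrite mulrC ler_pdivlMr // mul1r n1 ler_pdivrMr //=.
  by apply: le_trans (ltW n2) _; rewrite exprS ler_pM2r.
have [|n /andP[n1 n2]] := pow y^-1; first by rewrite invf_ge1 // ltW.
have [a [b [ab E _]]] := fP n.+1; exists a, b; split=> //; rewrite E.
apply/andP; split.
  by rewrite -ler_pdivrMr // div1r ltW.
rewrite -ler_pdivlMr // exprS; apply: ler_pM => //; rewrite ?exprn_ge0 //; lra.
Qed.

(** [key] records the norm and the residues modulo it, so it takes finitely many values. In each
    class that occurs, [y] is the conjugate of a chosen representative. *)
Lemma quat_classes p (N : nat) : exists2 B : R, 0 <= B & forall q : quat,
  0 < quat_norm p q -> quat_norm p q <= N%:Z ->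
  exists y r : quat, [/\ mx_sqr_sum (quat_mx R p y) <= B, quat_norm p r = 1 &
    quat_mx R p y *m quat_mx R p q = (quat_norm p q)%:~R *: quat_mx R p r].
Proof.
pose key (q : quat) : 'I_N.+1 * ('I_N.+1 * 'I_N.+1 * 'I_N.+1 * 'I_N.+1) :=
  let n := quat_norm p q in let: (a, b, c, d) := q in
  let f (u : int) : 'I_N.+1 := inord (absz (u %% n)%Z) in
  (inord (absz n), (f a, f b, f c, f d)).
have keyE q q0 : 0 < quat_norm p q <= N%:Z -> 0 < quat_norm p q0 <= N%:Z -> key q = key q0 ->
  exists r : quat, quat_norm p r = 1 /\
    quat_mx R p (quat_conj q0) *m quat_mx R p q = (quat_norm p q)%:~R *: quat_mx R p r.
  rewrite /key => /andP[q0p qN] /andP[q00p q0N].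
  have ordK (u v : int) : 0 <= u <= N%:Z -> 0 <= v <= N%:Z ->
      inord (absz u) = inord (absz v) :> 'I_N.+1 -> u = v.
    move=> uN vN /(congr1 val) /=; rewrite !inordK; lia.
  case: q q0 q0p qN q00p q0N => [[[a b] c] d] [[[a0 b0] c0] d0].
  set n := quat_norm p (a, b, c, d); set n0 := quat_norm p _ => np nN n0p n0N.
  case=> /ordK; rewrite ?(ltW np) ?(ltW n0p) nN n0N => /(_ isT isT) nn; rewrite -nn.
  have cong (u v : int) : inord (absz (u %% n)%Z) = inord (absz (v %% n)%Z) :> 'I_N.+1 ->
      exists w, u = v + n * w.
    have modN (z : int) : 0 <= (z %% n)%Z <= N%:Z.
      rewrite modz_ge0 ?gt_eqF //=; apply: ltW; apply: lt_le_trans nN; exact: ltz_pmod.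
    move=> /ordK => /(_ (modN u) (modN v)) uv.
    exists ((u %/ n)%Z - (v %/ n)%Z).
    move: (divz_eq u n) (divz_eq v n); rewrite uv.
    by move: (u %/ n)%Z (v %/ n)%Z (v %% n)%Z => x y r -> ->; ring.
  (* [q = q0 + n w] gives [conj q0 * q = n (1 + conj q0 * w)] *)
  move=> /cong[a1 aE] /cong[b1 bE] /cong[c1 cE] /cong[d1 dE].
  pose r := quat_mul p (quat_conj (a0, b0, c0, d0)) (a1, b1, c1, d1).
  pose r1 : quat := (1 + r.1.1.1, r.1.1.2, r.1.2, r.2).
  have E : quat_mx R p (quat_conj (a0, b0, c0, d0)) *m quat_mx R p (a, b, c, d) = n%:~R *: quat_mx R p r1.
    rewrite -quat_mxM.
    have -> : quat_mul p (quat_conj (a0, b0, c0, d0)) (a, b, c, d) =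
      (n * r1.1.1.1, n * r1.1.1.2, n * r1.1.2, n * r1.2).
      rewrite aE bE cE dE nn /n0 /r1 /r /=; congr (_, _, _, _); ring.
    by rewrite -quat_mxZ; case: (r1) => [[[e f] g] h].
  exists r1; split=> //.
  (* Determinants give [n ^ 2 = n ^ 2 * quat_norm p r1]. *)
  move/(congr1 determinant): E; rewrite det_mulmx detZ !det_quat_mx quat_norm_conj -/n -/n0 -nn.
  rewrite -expr2 -[LHS]mulr1 -!rmorphXn => /mulfI; rewrite intr_eq0 expf_neq0 ?gt_eqF //.
  by move=> /(_ isT) /esym; rewrite -[1]/(1%:~R) => /intr_inj.
have class t : exists B : R, 0 <= B /\ forall q, key q = t ->
  0 < quat_norm p q <= N%:Z -> exists y r : quat, [/\ mx_sqr_sum (quat_mx R p y) <= B, quat_norm p r = 1 &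
    quat_mx R p y *m quat_mx R p q = (quat_norm p q)%:~R *: quat_mx R p r].
  case: (pselect (exists q0, key q0 = t /\ 0 < quat_norm p q0 <= N%:Z)) => [[q0 [<- q0N]]|no].
    exists (mx_sqr_sum (quat_mx R p (quat_conj q0))); split; first by rewrite !addr_ge0 ?sqr_ge0.
    move=> q qE qN; have [r [r1 rE]] := keyE q q0 qN q0N qE.
    by exists (quat_conj q0), r.
  by exists 0; split=> // q qt qN; case: no; exists q.
have [B BP] := fin_all_exists class.
(* The sum of the nonnegative bounds dominates each of them. *)
exists (\sum_t B t); first by apply: sumr_ge0 => t _; case: (BP t).
move=> q q0 qN; have [_ /(_ q erefl)] := BP (key q).
rewrite q0 qN => /(_ isT) [y [r [yB r1 E]]]; exists y, r; split=> //.
apply: le_trans yB _; rewrite (bigD1 (key q)) //= lerDl.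
by apply: sumr_ge0 => t _; case: (BP t).
Qed.

Lemma box_reduction p : inert3 p -> exists2 C : R, 1 <= C & forall z : H,
  exists2 A, quat_SL2 R p A & box C (SL2_act A z).
Proof.
move=> pi; have p0 : (0 < p)%N := prime_gt0 pi.1.
pose k : R := (8 * p)%:R.
(* The bracket bounds the form of a matrix from [exists_small_quat] at height at most 16; the factor
   6 is the sum of squared entries of i, by which an element of negative norm gets multiplied. *)
pose C0 : R := 6 * (2 * k ^+ 2 * 16 ^+ 2 + 2).
have [B B0 BP] := quat_classes p (Num.truncn C0).
pose C1 := 1 + B * C0.
have C00 : 0 <= C0 by rewrite mulr_ge0 // addr_ge0 // !mulr_ge0 // exprn_ge0.
exists C1; first by rewrite lerDl mulr_ge0.
move=> z.
have [a [b [ab zb]]] := exists_scaled (hp_im_gt0 z).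
have [|E GE Emx] := @quat_SL2P R p (a, b, 0, 0); first by rewrite -[RHS]ab /=; ring.
pose w := SL2_act E z.
have wE : hp_im w = (a%:~R + b%:~R * s3 R) ^+ 2 * hp_im z.
  rewrite SL2_act_im Emx /denom !mxE /= !mul0r subrr !mul0r add0r expr0n addr0.
  have h : (a%:~R + b%:~R * s3 R) ^+ 2 * (a%:~R - b%:~R * s3 R) ^+ 2 = 1.
    have ss := s3_sqr R.
    have E1 : (a%:~R + b%:~R * s3 R) * (a%:~R - b%:~R * s3 R) = (a ^+ 2 - 3 * b ^+ 2)%:~R.
      rewrite rmorphB /= rmorphXn /= rmorphM /= rmorphXn /=; ring: ss.
    by rewrite -exprMn E1 ab expr1n.
  have nz : (a%:~R - b%:~R * s3 R) ^+ 2 != 0.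
    by apply: contra_eq_neq h => ->; rewrite mulr0 eq_sym oner_neq0.
  by apply: (mulIf nz); rewrite divfK // mulrAC h mul1r.
have /andP[w1 w16] : 1 <= hp_im w <= 16 by rewrite wE.
suff [A GA Abox] : exists2 A, quat_SL2 R p A & box C1 (SL2_act A w).
  exists (A * E)%g; last by rewrite SL2_actM.
  case: GA GE => [q qE] [r rE]; exists (quat_mul p q r).
  by rewrite quat_mxM SL2_mxM qE rE.
have [q [q0 q_small]] := exists_small_quat (hp_re w) p0.
pose X := quat_mx R p q.
have QX : hs_form X (hp_re w) (hp_im w) <= 2 * k ^+ 2 * 16 ^+ 2 + 2.
  case: q_small; rewrite /hs_form /denom -/X -/k.
  have sq (u v : R) : `|u| < v -> u ^+ 2 <= v ^+ 2.
    by move=> uv; rewrite -real_normK ?num_real // lerXn2r ?nnegrE ?(le_trans _ (ltW uv)) // ltW.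
  move=> /sq h1 /sq h2 /sq h3 /sq h4.
  have y2 : hp_im w ^+ 2 <= 16 ^+ 2 by rewrite lerXn2r ?nnegrE //; lra.
  rewrite !exprMn !expr1n in h3 h4 *.
  have := ler_pM (sqr_ge0 _) (sqr_ge0 _) h1 y2.
  have := ler_pM (sqr_ge0 _) (sqr_ge0 _) h2 y2.
  lra.
have [q' qpos Q'] : exists2 q', 0 < quat_norm p q' & hs_form (quat_mx R p q') (hp_re w) (hp_im w) <= C0.
  case: (ltgtP (quat_norm p q) 0) => [qn|qn|/eqP]; last first.
  - by rewrite inert3_quat_norm // => /eqP.
  - by exists q => //; apply: le_trans QX _; rewrite /C0; have := sqr_ge0 k; lra.
  (* The norm of i is -3, so this product has positive norm. *)
  exists (quat_mul p (0, 1, 0, 0) q).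
    by rewrite quat_normM /= ; lia.
  rewrite quat_mxM; apply: le_trans (hs_form_mul _ _ _ _) _; apply: ler_pM => //.
  - by rewrite !addr_ge0 ?sqr_ge0.
  - by rewrite !addr_ge0 ?sqr_ge0.
  - rewrite /mx_sqr_sum !mxE /=; have := s3_sqr R; nra.
have qC : (quat_norm p q')%:~R <= C0.
  rewrite -det_quat_mx; apply: le_trans (ler_norm _) _.
  by apply: le_trans Q'; apply: det_le_hs_form.
have qN : quat_norm p q' <= (Num.truncn C0)%:Z.
  move: qpos qC; case: (quat_norm p q') => // m _ mC.
  by rewrite lez_nat truncn_ge_nat.
have [y [r [yB r1 E']]] := BP q' qpos qN.
have [A GA AE] := quat_SL2P R r1; exists A => //.
apply: hs_form_box => //; rewrite AE.
set n : R := (quat_norm p q')%:~R in E'.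
have n1 : 1 <= n by rewrite /n ler1z; lia.
have hsZ M x1 y1 : hs_form (n *: M) x1 y1 = n ^+ 2 * hs_form M x1 y1.
  by rewrite /hs_form /denom !mxE; ring.
have hs0 M x1 y1 : 0 <= hs_form M x1 y1 by rewrite !addr_ge0 ?sqr_ge0.
(* As [n] is at least 1, scaling by it does not decrease the form, and [n r] is the product
   [y q']. *)
apply: (@le_trans _ _ (hs_form (n *: quat_mx R p r) (hp_re w) (hp_im w))).
  by rewrite hsZ ler_peMl // expr_ge1 //; lra.
rewrite -E'; apply: le_trans (hs_form_mul _ _ _ _) _; rewrite /C1.
have := ler_pM _ (hs0 _ _ _) yB Q'; rewrite !addr_ge0 ?sqr_ge0 // => /(_ isT); lra.
Qed.

End ReductionBox.

(** * Compactness of the quotient *)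

Section Cocompact.
Variable R : realType.
Local Notation H := (upper_half_plane R).
Implicit Types (g h : PSL2 R) (z w : H) (G : set (PSL2 R)).

Lemma actM g h z : act (g * h)%g z = act g (act h z).
Proof. by rewrite -[g]reprK -[h]reprK -pi_PSL2M !act_pi SL2_actM. Qed.

Lemma same_orbit_act G g z : group_closed (mem G) -> G g -> same_orbit G (act g z) z.
Proof.
move=> GG Gg; apply/asboolP/seteqP; have GM := group_closedM GG; have GV := group_closedV GG.
split=> _ [h Gh <-].
  exists (h * g)%g; last by rewrite actM.
  by have := GM h g; rewrite !inE; exact.
exists (h * g^-1)%g; last by rewrite -actM -mulgA mulVg mulg1.
have := GM h g^-1%g; rewrite !inE; apply=> //.
by have := GV g; rewrite !inE; exact.
Qed.

Lemma complex_fun_continuous (f g : R * R -> R) : continuous f -> continuous g ->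
  continuous (fun v => (f v +i* g v)%C : R[i]^o).
Proof.
move=> cf cg v; apply/cvgrPdist_lt => /= e e0.
have e0' : 0 < complex.Re e by move: e0; rewrite ltcE => /andP[].
(* A positive element of [R[i]] is real. *)
have eE : e = (complex.Re e)%:C%C.
  by move: e0; case: (e) => a b; rewrite ltcE /= => /andP[/eqP->].
have e2 : 0 < complex.Re e / 2 by rewrite divr_gt0.
near=> u.
have hf : `|f v - f u| < complex.Re e / 2 by near: u; exact: cvgr_dist_lt (cf v) _ e2.
have hg : `|g v - g u| < complex.Re e / 2 by near: u; exact: cvgr_dist_lt (cg v) _ e2.
rewrite eE normc_def /= ltcR.
rewrite -[ltRHS]ger0_norm ?(ltW e0') // -sqrtr_sqr ltr_sqrt ?exprn_gt0 //.
have sq (r : R) : `|r| < complex.Re e / 2 -> r ^+ 2 < (complex.Re e / 2) ^+ 2.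
  by move=> h; rewrite -real_normK ?num_real // ltrXn2r // ?nnegrE ?ltW.
have := sq _ hf; have := sq _ hg; rewrite exprMn; have := exprn_gt0 2 e0'; lra.
Unshelve. all: by end_near.
Qed.

(** The exponential makes the chart total on the plane, and [box C] becomes the image of a compact
    rectangle with sides [- C, C] and [- ln C, ln C]. *)
Definition half_plane_chart (v : R * R) : H :=
  mkH (expR_gt0 v.2 : 0 < complex.Im (v.1 +i* expR v.2)%C).

Lemma half_plane_chart_continuous : continuous half_plane_chart.
Proof.
apply: continuous_comp_initial.
have -> : set_val \o half_plane_chart = (fun v => (v.1 +i* expR v.2)%C : R[i]^o).
  by apply/funext => v /=; rewrite set_valE.
apply: complex_fun_continuous => v; first exact: cvg_fst.
apply: continuous_comp; [exact: cvg_snd | exact: continuous_expR].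
Qed.

Lemma cocompact_of_box G C : group_closed (mem G) -> 1 <= C ->
  (forall z, exists2 g, G g & box C (act g z)) -> cocompact G.
Proof.
move=> GG C1 red; pose D := `[- C, C]%classic `*` `[- ln C, ln C]%classic : set (R * R).
pose f : R * R -> orbit_space G := \pi_(orbit_space G) \o half_plane_chart.
have cf : continuous f.
  by move=> v; apply: continuous_comp; [exact: half_plane_chart_continuous | exact: pi_continuous].
rewrite /cocompact; suff -> : [set: orbit_space G] = f @` D.
  apply: continuous_compact; first exact: continuous_subspaceT.
  by apply: compact_setX; exact: segment_compact.
apply/esym/seteqP; split=> // x _.
rewrite -[x]reprK; have [g Gg [h1 h2 h3]] := red (repr x).
have C0 : 0 < C by exact: lt_le_trans C1.
have y0 := hp_im_gt0 (act g (repr x)).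
exists (hp_re (act g (repr x)), ln (hp_im (act g (repr x)))).
  split; rewrite /= in_itv /=; first by rewrite -ler_norml.
  by rewrite -lnV ?ler_ln ?posrE ?invr_gt0 // h2.
rewrite /f /=; have -> : half_plane_chart (hp_re (act g (repr x)), ln (hp_im (act g (repr x)))) = act g (repr x).
  by apply: hp_ext; rewrite /half_plane_chart /hp_re /hp_im hp_val_mkH //= lnK ?posrE.
by apply/eqmodP; exact: same_orbit_act.
Qed.

End Cocompact.

Lemma cocompact_quat_PSL2 (R : realType) (p : nat) : inert3 p -> cocompact (quat_PSL2 R p).
Proof.
move=> pi; have [C C1 red] := box_reduction R pi.
apply: (cocompact_of_box (group_quat_PSL2 R p) C1) => z.
have [A GA zA] := red z; exists (\pi_(PSL2 R) A); first by exists A.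
by rewrite act_pi.
Qed.

(** * Finite area *)

Section HyperbolicArea.
Variable R : realType.
Local Notation H := (upper_half_plane R).
Local Notation plane := (measurableTypeR R * measurableTypeR R)%type.

Lemma hp_coords_re_im (z : H) : hp_coords z = (hp_re z, hp_im z). Proof. by []. Qed.

Lemma measurable_area_density : measurable_fun [set: plane] (fun v : plane => ((v.2 : R) ^- 2)%:E).
Proof.
have -> : (fun v : plane => ((v.2 : R) ^- 2)%:E) = EFin \o ((@powR R ^~ (-1)) \o (fun v : plane => (v.2 : R) ^+ 2)).
  by apply/funext => v /=; rewrite powR_inv1 // sqr_ge0.
apply: measurableT_comp; first exact: EFin_measurable.
apply: measurableT_comp; first exact: measurable_powR.
by apply: measurable_funX; exact: measurable_snd.
Qed.

(** A point is a product of two null sets. This serves for overlaps of translates of the fundamental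
    domain. *)
Lemma area_subsingleton (F : set H) : (forall z w, F z -> F w -> z = w) -> hyperbolic_area F = 0%E.
Proof.
move=> F1; rewrite /hyperbolic_area.
case: (pselect (exists z, F z)) => [[z Fz]|no]; last first.
  suff -> : @hp_coords R @` F = set0 by rewrite integral_set0.
  by apply/seteqP; split=> // v [w Fw _]; case: no; exists w.
have -> : @hp_coords R @` F = [set hp_re z] `*` [set hp_im z].
  apply/seteqP; split=> [_ [w Fw <-]|[x y] [/= -> ->]]; first by rewrite (F1 w z).
  by exists z.
apply: null_set_integral.
- by apply: measurableX; exact: measurable_set1.
- by apply: measurable_funS measurable_area_density.
- transitivity (@lebesgue_measure R [set hp_re z] * @lebesgue_measure R [set hp_im z])%E.
    by apply: product_measure1E; exact: measurable_set1.
  by rewrite !lebesgue_measure_set1 mul0e.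
Qed.

Lemma area_box_lty (C : R) (F : set H) : 1 <= C -> F `<=` box C ->
  measurable (@hp_coords R @` F) -> (hyperbolic_area F < +oo)%E.
Proof.
move=> C1 FC mF; rewrite /hyperbolic_area.
have C0 : 0 < C by lra.
pose I : set (measurableTypeR R) := `[- C, C]%classic; pose J : set (measurableTypeR R) := `[C^-1, C]%classic.
pose mu : {measure set plane -> \bar R} := (lebesgue_measure \x lebesgue_measure)%E.
apply: (@le_lt_trans _ _ (\int[mu]_(v in @hp_coords R @` F) cst ((C ^+ 2)%:E) v)%E).
  apply: ge0_le_integral => //.
  - by move=> v _; rewrite lee_fin invr_ge0 sqr_ge0.
  - exact: measurable_funS measurable_area_density.
  - move=> v [z Fz <-] /=; rewrite lee_fin -/(hp_im z); have [_ h _] := FC _ Fz.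
    rewrite -[C ^+ 2]invrK lef_pV2 ?posrE ?invr_gt0 ?exprn_gt0 ?hp_im_gt0 //.
    by rewrite -exprVn lerXn2r // nnegrE ?invr_ge0 ?ltW ?hp_im_gt0.
rewrite integral_cst // lte_mul_pinfty ?lee_fin ?sqr_ge0 //.
apply: (@le_lt_trans _ _ (mu (I `*` J))).
  apply: le_measure; rewrite ?inE //; first by apply: measurableX; exact: measurable_itv.
  by move=> _ [z Fz <-]; have [h1 h2 h3] := FC _ Fz; split; rewrite /I /J /= in_itv /= -?ler_norml ?h2.
have -> : mu (I `*` J) = (@lebesgue_measure R I * @lebesgue_measure R J)%E.
  by apply: product_measure1E; exact: measurable_itv.
rewrite !lebesgue_measure_itv /=.
by do 2 case: ifP => _; rewrite ?mul0e ?mule0 // -!EFinB -EFinM ltry.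
Qed.

(** A fixed point is a root of the real quadratic c z^2 + (d - a) z - b, which has at most one root
    in the half-plane unless it vanishes identically, that is, unless [A] is plus or minus the
    identity. *)
Lemma SL2_act_fix (A : SL2 R) (z w : H) : \pi_(PSL2 R) A <> 1%g ->
  SL2_act A z = z -> SL2_act A w = w -> z = w.
Proof.
move=> A1.
have fixE u : SL2_act A u = u ->
    SL2_mx A 0 0 = 2 * SL2_mx A 1 0 * hp_re u + SL2_mx A 1 1 /\
    SL2_mx A 0 1 = - SL2_mx A 1 0 * (hp_re u ^+ 2 + hp_im u ^+ 2).
  move=> /(congr1 (@hp_val R)); rewrite hp_val_act /homography => E.
  have := denomC_neq0 A u; have := hp_im_gt0 u.
  move: E; rewrite /hp_re /hp_im; case: (hp_val u) => x y /= E y0 nz.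
  move: (divfK nz ((SL2_mx A 0 0)%:C%C * (x +i* y)%C + (SL2_mx A 0 1)%:C%C)); rewrite E.
  move=> /eqP; rewrite eq_complex /= => /andP[/eqP h1 /eqP h2].
  have {}h2 : (SL2_mx A 0 0 - (2 * SL2_mx A 1 0 * x + SL2_mx A 1 1)) * y = 0.
    move: h2; lra.
  move/eqP: h2; rewrite mulf_eq0 (gt_eqF y0) orbF subr_eq0 => /eqP h2; split=> //.
  by move: h1; rewrite h2; nra.
move=> /fixE [az bz] /fixE [aw bw].
have c0 : SL2_mx A 1 0 != 0.
  apply/eqP => c0; apply: A1; apply/eq_PSL2; rewrite /pm_eq.
  have ad : SL2_mx A 0 0 = SL2_mx A 1 1 by rewrite az c0; ring.
  have b0 : SL2_mx A 0 1 = 0 by rewrite bz c0; ring.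
  have := det_SL2 A; rewrite det_mx2 c0 b0 ad mulr0 subr0 -expr2 => /eqP.
  rewrite sqrf_eq1 => /orP[/eqP d1|/eqP d1]; apply/orP; [left|right]; apply/eqP;
    apply: SL2_mx_inj; rewrite [SL2_mx A]mx2_eta c0 b0 ad d1 !mkSL2K [RHS]mx2_eta !mxE /=; congr mx2; ring.
have xx : hp_re z = hp_re w by apply: (mulfI c0); lra.
apply: hp_ext => //; apply/eqP; rewrite -(eqrXn2 (_ : 0 < 2)%N) ?ltW ?hp_im_gt0 //; apply/eqP.
by apply: (mulfI c0); rewrite xx in bz; nra.
Qed.

End HyperbolicArea.

(** * The lexicographic fundamental domain *)

Section FundamentalDomain.
Variable R : realType.
Local Notation H := (upper_half_plane R).
Local Notation plane := (measurableTypeR R * measurableTypeR R)%type.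

Definition lex_le (x y x' y' : R) : bool := (x < x') || (x == x') && (y <= y').

Lemma exists_lex_min (T : finType) (P : pred T) (f g : T -> R) t0 : P t0 ->
  exists2 t, P t & forall t', P t' -> lex_le (f t) (g t) (f t') (g t').
Proof.
move=> Pt0; case: (@arg_minP _ _ _ t0 P f Pt0) => t1 Pt1 min1.
case: (@arg_minP _ _ _ t1 (fun t => P t && (f t == f t1)) g).
  by rewrite Pt1 eqxx.
move=> t2 /andP[Pt2 /eqP ft2] min2; exists t2 => // t' Pt'.
rewrite /lex_le ft2; have := min1 t' Pt'; rewrite le_eqVlt => /orP[/eqP e|-> //].
by rewrite e eqxx /= min2 ?orbT // Pt' e eqxx.
Qed.

(** Properness of the action. The lower bound on the height of the image bounds |c z + d|^2, the
    bound on its real part then bounds |a z + b|^2, and [K] bounds their sum; the summand 1 makes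
    [K] bound its own square root. *)
Lemma box_entries_lt (C : R) (z : H) : 1 <= C -> exists M : R, forall A : SL2 R,
  box C (SL2_act A z) -> forall i j, `|SL2_mx A i j| < M.
Proof.
move=> C1; have y0 := hp_im_gt0 z.
pose K := 1 + (C ^+ 3 + 2 * C) * hp_im z.
pose L := K / hp_im z.
exists (1 + K + L + L * `|hp_re z|) => A [].
rewrite SL2_act_re SL2_act_im.
have D0 := denom_gt0 A (hp_re z) y0.
have E := hs_form_det (SL2_mx A) (hp_re z) (hp_im z).
have C3 : 0 <= C ^+ 3 by rewrite exprn_ge0 //; lra.
have K1 : 1 <= K by rewrite lerDl mulr_ge0 ?(ltW y0) //; lra.
move: E; rewrite det_SL2 mul1r /L.
move: (hp_re z) (hp_im z) y0 @K @L D0 K1 => x y y0 K L D0 K1 E.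
set N := _ + _ in E; set D := denom _ _ _ in E D0 *; set r := numer_re _ _ _ in E *.
rewrite normrM normfV (gtr0_norm D0) ler_pdivrMr // ler_pdivlMr // ler_pdivrMr // => h1 h2 h3.
have DC : D <= C * y by rewrite -ler_pdivrMl //; lra.
have NK : N + D <= K.
  have r2 : r ^+ 2 <= (C * D) ^+ 2.
    by rewrite -real_normK ?num_real // lerXn2r // nnegrE mulr_ge0 //; lra.
  have NE : N <= C ^+ 2 * D + C * y.
    rewrite -(ler_pM2r D0) E; apply: le_trans (lerD r2 (lexx _)) _.
    have : y ^+ 2 <= C * y * D by rewrite expr2; nra.
    rewrite exprMn; nra.
  have : C ^+ 2 * D <= C ^+ 2 * (C * y) by rewrite ler_wpM2l ?sqr_ge0.
  rewrite /K; lra.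
have sq (u : R) : u ^+ 2 <= K -> `|u| <= K.
  move=> uK; rewrite -ler_sqr ?nnegrE ?(le_trans _ K1) // real_normK ?num_real //.
  by apply: le_trans uK _; rewrite expr2 ler_peMr //; lra.
have row (a b : R) : (a * x + b) ^+ 2 + (a * y) ^+ 2 <= K ->
    `|a| <= L /\ `|b| <= K + L * `|x|.
  move=> abK; have aL : `|a| <= L.
    rewrite /L ler_pdivlMr // -[X in _ * X](gtr0_norm y0) -normrM.
    by apply: sq; have := sqr_ge0 (a * x + b); lra.
  split=> //; have -> : b = a * x + b - a * x by ring.
  apply: le_trans (ler_normB _ _) _; apply: lerD.
    by apply: sq; have := sqr_ge0 (a * y); lra.
  by rewrite normrM ler_wpM2r.
have [a1 b1] : `|SL2_mx A 0 0| <= L /\ `|SL2_mx A 0 1| <= K + L * `|x|.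
  by apply: row; rewrite -/N; lra.
have [c1 d1] : `|SL2_mx A 1 0| <= L /\ `|SL2_mx A 1 1| <= K + L * `|x|.
  apply: row; change (D <= K); have : 0 <= N by rewrite addr_ge0 ?sqr_ge0.
  lra.
have L0 : 0 <= L by apply: le_trans a1.
have Lx : 0 <= L * `|x| by rewrite mulr_ge0.
move=> i j; rewrite [SL2_mx A]mx2_eta mxE; case: ifP => _; case: ifP => _; rewrite -/L; lra.
Qed.

(** Antisymmetry of the lexicographic order leaves at most one point of each orbit. *)
Definition lex_domain (p : nat) (C : R) : set H := [set z | box C z /\
  forall A, quat_SL2 R p A -> box C (SL2_act A z) ->
    lex_le (hp_re z) (hp_im z) (hp_re (SL2_act A z)) (hp_im (SL2_act A z))].

Lemma lex_domain_meets p C z : (0 < p)%N -> 1 <= C ->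
  (forall z, exists2 A, quat_SL2 R p A & box C (SL2_act A z)) ->
  exists2 A, quat_SL2 R p A & lex_domain p C (SL2_act A z).
Proof.
move=> p0 C1 red; have [M HM] := box_entries_lt z C1.
pose N := Num.bound M.
pose T := ('I_(N + N).+1 * 'I_(N + N).+1 * 'I_(N + N).+1 * 'I_(N + N).+1)%type.
(* By [box_entries_lt] the elements taking [z] into the box have coefficients in [- N, N]; [q]
   enumerates these quadruples, so the minimum is over a finite set. *)
pose q (t : T) : quat := ((t.1.1.1)%:Z - N%:Z, (t.1.1.2)%:Z - N%:Z, (t.1.2)%:Z - N%:Z, (t.2)%:Z - N%:Z).
have qT A x : SL2_mx A = quat_mx R p x -> box C (SL2_act A z) -> exists t, q t = x.
  move=> Ax /HM; rewrite Ax; case: x Ax => [[[a b] c] d] _.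
  move=> /(quat_mx_coef_lt p0)[h1 h2 h3 h4].
  have ord (u : int) : `|u%:~R : R| < M -> exists k : 'I_(N + N).+1, (k : nat)%:Z - N%:Z = u.
    move=> uM; have : `|u| < N%:Z.
      by rewrite -(ltr_int R) intr_norm; apply: lt_trans (uM) _; apply: archi_boundP; exact: le_trans (ltW uM).
    move=> uN; have kN : (absz (u + N%:Z)%R < (N + N).+1)%N by lia.
    by exists (Ordinal kN) => /=; lia.
  have [[ka <-] [kb <-] [kc <-] [kd <-]] := And4 (ord _ h1) (ord _ h2) (ord _ h3) (ord _ h4).
  by exists (ka, kb, kc, kd).
pose P (t : T) : bool := `[< exists2 A, SL2_mx A = quat_mx R p (q t) & box C (SL2_act A z) >].
pose f t := numer_re (quat_mx R p (q t)) (hp_re z) (hp_im z) / denom (quat_mx R p (q t)) (hp_re z) (hp_im z).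
pose g t := hp_im z / denom (quat_mx R p (q t)) (hp_re z) (hp_im z).
have [A0 [x0 A0x] A0z] := red z.
have [t0 t0x] := qT _ _ A0x A0z.
have Pt0 : P t0 by apply/asboolP; exists A0; rewrite // t0x.
have [t /asboolP[A At Az] tmin] := exists_lex_min f g Pt0.
exists A; first by exists (q t).
split=> // B [y By]; rewrite -SL2_actM => BAz.
have BAy : SL2_mx (B * A)%g = quat_mx R p (quat_mul p y (q t)).
  by rewrite quat_mxM SL2_mxM By At.
have [t' t'E] := qT _ _ BAy BAz.
have Pt' : P t' by apply/asboolP; exists (B * A)%g; rewrite // t'E.
by have := tmin t' Pt'; rewrite /f /g t'E -BAy -At -!SL2_act_re -!SL2_act_im.
Qed.

(** A point of the overlap and its preimage are both minimal in one orbit, hence equal; it is thus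
    fixed by [A], which has at most one fixed point. *)
Lemma lex_domain_overlap p C (A : SL2 R) : quat_SL2 R p A -> \pi_(PSL2 R) A <> 1%g ->
  hyperbolic_area (lex_domain p C `&` SL2_act A @` lex_domain p C) = 0%E.
Proof.
move=> GA A1; apply: area_subsingleton.
have fixed z : (lex_domain p C `&` SL2_act A @` lex_domain p C) z -> SL2_act A z = z.
  case=> -[zb zmin] [w [wb wmin] wz].
  have wE : w = SL2_act A^-1%g z by rewrite -wz -SL2_actM mulVg SL2_act1.
  have GV : quat_SL2 R p A^-1%g.
    by case: GA => x Ax; exists (quat_conj x); exact: quat_SL2V.
  have := wmin A GA; rewrite wz => /(_ zb) h1.
  have := zmin _ GV; rewrite -wE => /(_ wb) h2.
  suff E : w = z by rewrite -[in LHS]E.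
  move: h1 h2; rewrite /lex_le => h1 h2; apply: hp_ext; lra.
move=> z w /fixed zA /fixed wA; exact: SL2_act_fix A1 zA wA.
Qed.

(** The minimality condition against one element, with denominators cleared so that its
    measurability is that of polynomial inequalities. Indexing by all of [quat] makes the
    intersection below countable. *)
Definition lex_domain_test (p : nat) (C : R) (q : quat) (v : plane) : bool :=
  let A := quat_mx R p q in let x : R := v.1 in let y : R := v.2 in
  let n := numer_re A x y in let D := denom A x y in
  (quat_norm p q == 1) ==>
  [&& - (C * D) <= n, n <= C * D, C^-1 * D <= y & y <= C * D] ==>
  (x * D < n) || (x * D == n) && (y * D <= y).

Lemma lex_domain_coords p C : 1 <= C -> @hp_coords R @` lex_domain p C =
  (`[- C, C]%classic `*` `[C^-1, C]%classic) `&`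
  \bigcap_(q in [set: quat]) [set v | lex_domain_test p C q v].
Proof.
move=> C1; have C0 : 0 < C by lra.
have testP (A : SL2 R) (q : quat) (z : H) : SL2_mx A = quat_mx R p q ->
  lex_domain_test p C q (hp_coords z) <->
  (box C (SL2_act A z) -> lex_le (hp_re z) (hp_im z) (hp_re (SL2_act A z)) (hp_im (SL2_act A z))).
  move=> Aq; rewrite /lex_domain_test (quat_SL2_norm Aq) eqxx /= -/(hp_re z) -/(hp_im z).
  rewrite /box /lex_le /= !SL2_act_re !SL2_act_im Aq.
  have D0 := denom_gt0 A (hp_re z) (hp_im_gt0 z); rewrite Aq in D0.
  move: D0; set D := denom _ _ _; set n := numer_re _ _ _ => D0.
  rewrite normrM normfV (gtr0_norm D0) ler_pdivrMr // ler_pdivlMr // ler_pdivrMr //.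
  rewrite ltr_pdivlMr // ler_pdivlMr // -[_ == n / D](inj_eq (mulIf (lt0r_neq0 D0))) divfK ?lt0r_neq0 //.
  rewrite ler_norml; split.
    by move=> /implyP h [/andP[h1 h2] h3 h4]; apply: h; rewrite h1 h2 h3 h4.
  by move=> h; apply/implyP => /and4P[h1 h2 h3 h4]; apply: h; rewrite h1 h2.
apply/seteqP; split.
  move=> _ [z [zb zmin] <-]; split.
    by have [h1 h2 h3] := zb; split; rewrite /= in_itv /= -?ler_norml ?h2.
  move=> q _ /=; case: (eqVneq (quat_norm p q) 1) => [q1|qn]; last first.
    by rewrite /lex_domain_test (negbTE qn).
  have [A GA Aq] := quat_SL2P R q1.
  by apply/(testP _ _ z Aq); exact: zmin.
move=> [x y] [[/= xC yC] test].
move: xC yC; rewrite !in_itv /= => xC /andP[yC1 yC2].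
have y0 : 0 < y by apply: lt_le_trans yC1; rewrite invr_gt0.
have hz : 0 < complex.Im (x +i* y)%C by [].
have zE : hp_coords (mkH hz) = (x, y) by rewrite hp_coords_re_im /hp_re /hp_im hp_val_mkH.
exists (mkH hz) => //; split.
  by split; rewrite /hp_re /hp_im hp_val_mkH //= ler_norml.
move=> A [q Aq]; apply/(testP _ _ _ Aq); rewrite zE; exact: test.
Qed.

Lemma measurable_lex_domain p C : 1 <= C -> measurable (@hp_coords R @` lex_domain p C).
Proof.
move=> /(lex_domain_coords p) ->; apply: measurableI.
  by apply: measurableX; exact: measurable_itv.
rewrite -[X in measurable X]setCK setC_bigcap; apply: measurableC.
apply: countable_bigcupT_measurable => [|q]; first exact: (@countableP (int * int * int * int)%type).
apply: measurableC.
have mx : measurable_fun [set: plane] (fun v : plane => v.1 : R) by exact: measurable_fst.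
have my : measurable_fun [set: plane] (fun v : plane => v.2 : R) by exact: measurable_snd.
have mc (c : R) : measurable_fun [set: plane] (fun=> c) by exact: measurable_cst.
set A := quat_mx R p q.
have mD : measurable_fun [set: plane] (fun v : plane => denom A (v.1 : R) (v.2 : R)).
  apply: measurable_funD; apply: measurable_funX.
    by apply: measurable_funD => //; apply: measurable_funM.
  by apply: measurable_funM.
have mn : measurable_fun [set: plane] (fun v : plane => numer_re A (v.1 : R) (v.2 : R)).
  apply: measurable_funD; apply: measurable_funM => //.
  - by apply: measurable_funD => //; apply: measurable_funM.
  - by apply: measurable_funD => //; apply: measurable_funM.
  - exact: measurable_funX.
have -> : [set v | lex_domain_test p C q v] = setT `&` lex_domain_test p C q @^-1` [set true].
  by apply/seteqP; split=> v //= [].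
have : measurable_fun [set: plane] (lex_domain_test p C q); last by apply=> //.
rewrite /lex_domain_test -/A.
have [q1|qn] := eqVneq (quat_norm p q) 1; last exact: measurable_cst.
under eq_fun do rewrite implyTb implybE.
have mCD (c : R) : measurable_fun [set: plane] (fun v : plane => c * denom A (v.1 : R) (v.2 : R)).
  exact: measurable_funM.
apply: measurable_or.
  apply: measurable_neg; repeat apply: measurable_and; apply: measurable_fun_ler => //.
  exact: measurableT_comp.
apply: measurable_or.
  by apply: measurable_fun_ltr => //; exact: measurable_funM.
apply: measurable_and.
  by apply: measurable_fun_eqr => //; exact: measurable_funM.
by apply: measurable_fun_ler => //; exact: measurable_funM.
Qed.

Lemma finite_area_quat_PSL2 p : inert3 p -> finite_area (quat_PSL2 R p).
Proof.
move=> pi; have p0 := prime_gt0 pi.1; have [C C1 red] := box_reduction R pi.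
have mF := measurable_lex_domain p C1.
exists (lex_domain p C); last by apply: (area_box_lty C1) => // z [].
split=> // [z|g [A GA <-] A1].
  have [A GA Az] := lex_domain_meets z p0 C1 red.
  by exists (\pi_(PSL2 R) A); rewrite ?act_pi //; exists A.
have -> : act (\pi_(PSL2 R) A) @` lex_domain p C = SL2_act A @` lex_domain p C.
  by apply/seteqP; split=> _ [w Fw <-]; exists w => //; rewrite act_pi.
exact: lex_domain_overlap.
Qed.

End FundamentalDomain.

(** * Non-commensurability *)

(** Among the cosets of the powers of [x] two coincide, and the positive difference of the exponents
    works. *)
Lemma finite_index_exp (T : groupType) (S G : set T) (x : T) :
  group_closed (mem S) -> group_closed (mem G) -> finite_index S G -> G x ->
  exists n, S (x ^+ n.+1)%g.
Proof.
move=> GS GG fin Gx.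
have Gxn n : G (x ^+ n)%g.
  elim: n => [|n IH]; first by have := GG.1; rewrite inE.
  by have GM := group_closedM GG; have := GM x (x ^+ n)%g; rewrite !inE -expgS; apply.
pose f (n : nat) : set T := [set (x ^+ n * s)%g | s in S].
have [i [j [ij fij]]] : exists i j, (i < j)%N /\ f i = f j.
  apply: contrapT => no.
  apply: infinite_nat; suff -> : [set: nat] = f @^-1` [set [set (g * s)%g | s in S] | g in G].
    apply: finite_preimage fin => i j _ _ fij.
    case: (ltngtP i j) => // lt; exfalso; apply: no; first by exists i, j.
    by exists j, i.
  by apply/seteqP; split=> // n _; exists (x ^+ n)%g.
have : f j (x ^+ j)%g by exists 1%g; rewrite ?mulg1 //; have := GS.1; rewrite inE.
rewrite -fij => -[s Ss sE]; exists (j - i).-1; rewrite prednK ?subn_gt0 //.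
suff -> : (x ^+ (j - i))%g = s by [].
by apply: (mulgI (x ^+ i)%g); rewrite -expgnDr subnKC ?sE // ltnW.
Qed.

Lemma group_conjugate (T : groupType) (G : set T) (g : T) :
  group_closed (mem G) -> group_closed (mem (conjugate G g)).
Proof.
move=> GG; split; first by rewrite inE; exists 1%g; [have := GG.1; rewrite inE | rewrite mulg1 mulgV].
move=> u v; rewrite !inE => -[x Gx <-] [y Gy <-]; exists (x * y^-1)%g.
  by have := GG.2 x y; rewrite !inE; exact.
by rewrite mulgKA invgM !mulgA.
Qed.

Lemma group_setI (T : groupType) (G G' : set T) :
  group_closed (mem G) -> group_closed (mem G') -> group_closed (mem (G `&` G')).
Proof.
move=> GG GG'; split; first by rewrite inE; split; [have := GG.1 | have := GG'.1]; rewrite inE.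
move=> u v; rewrite !inE => -[Gu Gu'] [Gv Gv']; split.
  by have := GG.2 u v; rewrite !inE; exact.
by have := GG'.2 u v; rewrite !inE; exact.
Qed.

Section Commensurability.
Variable R : realType.

(** The element e i + f i j has square 3 (e^2 - p f^2), so powers stay in the ring it generates;
    nonnegativity of the square keeps both coefficients positive. *)
Lemma quat_SL2_exp (p : nat) (A : SL2 R) (a b e f : int) n :
  0 < a -> 0 < b -> 0 <= e ^+ 2 - p%:Z * f ^+ 2 ->
  SL2_mx A = quat_mx R p (a, b * e, 0, b * f) ->
  exists a' b' : int, [/\ 0 < a', 0 < b' & SL2_mx (A ^+ n.+1)%g = quat_mx R p (a', b' * e, 0, b' * f)].
Proof.
move=> a0 b0 D0 Ax; elim: n => [|n [a' [b' [a'0 b'0 IH]]]]; first by exists a, b.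
exists (a * a' + 3 * (b * b' * (e ^+ 2 - p%:Z * f ^+ 2))), (a * b' + b * a'); split.
- by apply: ltr_wpDr; rewrite ?mulr_gt0 // mulr_ge0 // mulr_ge0 // mulr_ge0 // ltW.
- by rewrite addr_gt0 // mulr_gt0.
- rewrite expgS SL2_mxM IH Ax -quat_mxM; congr quat_mx; rewrite /=; congr (_, _, _, _); ring.
Qed.

(* [T = I J + 3 b] intertwines two square roots [I] and [b J] of [3 b ^ 2], so
   conjugation by [T] (or nothing, when [T = 0] and [I = - b J]) moves [I] to
   [b J]; this is Skolem-Noether for the field [Q(sqrt 3)]. *)
Lemma anticommuting_norm (q : nat) (b b1 c1 d1 : int) (z : quat) : inert3 q -> b != 0 ->
  3 * b1 ^+ 2 + q%:Z * (c1 ^+ 2 - 3 * d1 ^+ 2) = 3 * b ^+ 2 ->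
  quat_mx R q z *m quat_mx R q (0, b1, c1, d1) = - (quat_mx R q (0, b1, c1, d1) *m quat_mx R q z) ->
  exists m u v : int, m != 0 /\ m ^+ 2 * quat_norm q z = - q%:Z * (u ^+ 2 - 3 * v ^+ 2).
Proof.
move=> qi b0 sqI antiZ.
pose J := quat_mx R q (0, 1, 0, 0).
have q0 : (0 < q)%N := prime_gt0 qi.1.
have antiJ w : quat_mx R q w *m J = - (J *m quat_mx R q w) -> w = (0, 0, w.1.2, w.2).
  rewrite -!quat_mxM -quat_mx_opp => /(quat_mx_inj q0); case: w => [[[e f] g] h] /= [h1 h2 _ _].
  by congr (_, _, _, _); lia.
set I := quat_mx R q (0, b1, c1, d1) in antiZ.
pose t : quat := (3 * b1 + 3 * b, 0, - 3 * d1, - c1).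
have [t0|t0] := eqVneq t (0, 0, 0, 0).
  case: t0 => e1 e2 e3; exists 1, z.1.2, z.2; split=> //.
  have b1R : b1%:~R != 0 :> R by rewrite intr_eq0; lia.
  have IE : I = b1%:~R *: J.
    by rewrite -quat_mxZ /I; congr quat_mx; congr (_, _, _, _); lia.
  have zJ : quat_mx R q z *m J = - (J *m quat_mx R q z).
    by apply: (scalerI b1R); rewrite scalemxAr -IE antiZ IE -scalemxAl scalerN.
  by rewrite [X in quat_norm q X](antiJ _ zJ) /=; ring.
pose T := quat_mx R q t; pose T' := quat_mx R q (quat_conj t).
have IT : I *m T = b%:~R *: (T *m J).
  rewrite -!quat_mxM -quat_mxZ; congr quat_mx; rewrite /=.
  by congr (_, _, _, _); lia.
have TI : T' *m I = b%:~R *: (J *m T').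
  rewrite -!quat_mxM -quat_mxZ; congr quat_mx; rewrite /=.
  by congr (_, _, _, _); lia.
(* Up to the scalar [quat_norm q t] this is [z] conjugated by [t]. It anticommutes with i, so only
   its j and i j coefficients survive. *)
pose w := quat_mul q (quat_mul q (quat_conj t) z) t.
have wE : quat_mx R q w = T' *m quat_mx R q z *m T by rewrite !quat_mxM.
have wJ : quat_mx R q w *m J = - (J *m quat_mx R q w).
  have bR : b%:~R != 0 :> R by rewrite intr_eq0.
  apply: (scalerI bR); rewrite wE -mulmxA scalemxAr -IT !mulmxA -(mulmxA T') antiZ.
  by rewrite mulmxN mulNmx mulmxA TI -!scalemxAl scalerN.
exists (quat_norm q t), w.1.2, w.2; split; first by rewrite inert3_quat_norm.
transitivity (quat_norm q w); first by rewrite !quat_normM quat_norm_conj; ring.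
by rewrite (antiJ _ wJ) /=; ring.
Qed.

Lemma quat_SL2_not_conjugate (p q : nat) (X Y X' Y' B : SL2 R) (a b : int) (y y' x' : quat) :
  inert3 p -> inert3 q -> p != q -> b != 0 -> (y.1.2, y.2) != (0, 0) ->
  SL2_mx X = quat_mx R p (a, b, 0, 0) -> SL2_mx Y = quat_mx R p y ->
  SL2_mx X' = quat_mx R q x' -> SL2_mx Y' = quat_mx R q y' ->
  X = (B * X' * B^-1)%g -> Y = (B * Y' * B^-1)%g -> False.
Proof.
move=> pi qi pq b0 y0 Xx Yy X'x Y'y XE YE.
have p0 : (0 < p)%N := prime_gt0 pi.1; have q0 : (0 < q)%N := prime_gt0 qi.1.
have XB : SL2_mx X *m SL2_mx B = SL2_mx B *m SL2_mx X'.
  by rewrite -!SL2_mxM XE mulgVK.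
have YB : SL2_mx Y *m SL2_mx B = SL2_mx B *m SL2_mx Y'.
  by rewrite -!SL2_mxM YE mulgVK.
case: x' y y' y0 Xx Yy X'x Y'y => [[[a1 b1] c1] d1] [[[e f] g] h] [[[e1 f1] g1] h1] gh Xx Yy X'x Y'y; rewrite /= in gh.
have aa : a1 = a.
  have : \tr (SL2_mx X') = \tr (SL2_mx X).
    by rewrite XE !SL2_mxM -mulmxA mxtrace_mulC -mulmxA -SL2_mxM mulVg mulmx1.
  by rewrite X'x Xx !tr_quat_mx => /intr_inj /=; lia.
have N1 := quat_SL2_norm Xx; have N2 := quat_SL2_norm X'x.
pose z : quat := (0, 2 * q%:Z * (d1 * g1 - c1 * h1), 6 * (b1 * h1 - d1 * f1), 2 * (b1 * g1 - c1 * f1)).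
have [||m [u [v [m0 E]]]] := @anticommuting_norm q b b1 c1 d1 z qi b0.
- by move: N1 N2; rewrite /= aa; lia.
- by rewrite -!quat_mxM -quat_mx_opp; congr quat_mx; rewrite /z /=; congr (_, _, _, _); ring.
(* [z] is the commutator of [X'] and [Y']; conjugation by [B] carries it to that of [X] and [Y] and
   preserves determinants. *)
have NZ : quat_norm q z = quat_norm p (0, 0, 6 * (b * h), 2 * (b * g)).
  apply: (@intr_inj R); rewrite -!det_quat_mx.
  have zE : quat_mx R q z = SL2_mx X' *m SL2_mx Y' - SL2_mx Y' *m SL2_mx X'.
    by rewrite X'x Y'y quat_mx_commutator.
  have zpE : quat_mx R p (0, 0, 6 * (b * h), 2 * (b * g)) = SL2_mx X *m SL2_mx Y - SL2_mx Y *m SL2_mx X.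
    by rewrite Xx Yy quat_mx_commutator; congr quat_mx; congr (_, _, _, _); ring.
  rewrite zE zpE -[LHS]mul1r -(det_SL2 B) -det_mulmx -[RHS]mulr1 -(det_SL2 B) -det_mulmx.
  by rewrite mulmxBr mulmxBl !mulmxA -XB -YB -!mulmxA YB XB.
move: E; rewrite NZ => E.
have pq' : ~~ (p %| q)%N by rewrite dvdn_prime2 ?pi.1 ?qi.1.
have /andP[h0 g0] : (m * (6 * (b * h)) == 0) && (m * (2 * (b * g)) == 0).
  by apply: (inert3_norm (a := u) (b := v) pi pq'); apply: oppr_inj; rewrite -[RHS]mulNr -E /=; ring.
move: h0 g0; rewrite !mulf_eq0 (negbTE m0) (negbTE b0) /= => /eqP h0 /eqP g0.
by move: gh; rewrite h0 g0 eqxx.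
Qed.

(** Lifts conjugacy to SL(2, R); the sign is absorbed since the group is stable under negation. *)
Lemma quat_PSL2_conj (q : nat) (g : PSL2 R) (A : SL2 R) :
  conjugate (quat_PSL2 R q) g (\pi_(PSL2 R) A) ->
  exists2 A', quat_SL2 R q A' & A = (repr g * A' * (repr g)^-1)%g.
Proof.
case=> _ [A' GA' <-].
have -> : (g * \pi_(PSL2 R) A' * g^-1)%g = \pi_(PSL2 R) (repr g * A' * (repr g)^-1)%g.
  by rewrite !pi_PSL2M pi_PSL2V reprK.
move=> /esym /eq_PSL2 /orP[/eqP E|/eqP E]; first by exists A'.
exists (SL2_opp A'); first exact/quat_SL2_opp.
by rewrite SL2_oppMr SL2_oppMl.
Qed.

Lemma not_commensurable (p q : nat) : inert3 p -> inert3 q -> p != q ->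
  ~ commensurable (quat_PSL2 R p) (quat_PSL2 R q).
Proof.
move=> pi qi pq [g [fin _]]; set S := _ `&` _ in fin.
have GS : group_closed (mem S).
  by apply: group_setI; [|apply: group_conjugate]; exact: group_quat_PSL2.
have GG := group_quat_PSL2 R p.
have expS (A : SL2 R) : quat_SL2 R p A -> exists n, S (\pi_(PSL2 R) (A ^+ n.+1)%g).
  move=> GA; have [|n Sn] := @finite_index_exp _ _ _ (\pi_(PSL2 R) A) GS GG fin.
    by exists A.
  exists n; suff -> : \pi_(PSL2 R) (A ^+ n.+1)%g = (\pi_(PSL2 R) A ^+ n.+1)%g by [].
  by elim: (n) => [//|m IH]; rewrite expgS pi_PSL2M IH -expgS.
(* This is the unit 2 + i, written in the shape that [quat_SL2_exp] expects. *)
have [E GE Ex] : exists2 A, quat_SL2 R p A & SL2_mx A = quat_mx R p (2, 1 * 1, 0, 1 * 0).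
  by apply: quat_SL2P; rewrite /=; ring.
have [n [_ /quat_PSL2_conj[X' [x' X'x] XE]]] := expS E GE.
have [|||a [b [a0 b0 Xx]]] := @quat_SL2_exp p E 2 1 1 0 n _ _ _ Ex; rewrite ?mulr0 ?subr0 ?expr1n //.
have p1 := prime_gt1 pi.1.
(* [- (p + 1) i + 2 i j] has square [3 (p - 1) ^ 2], so a unit [c + d (p - 1) sqrt 3]
   of norm one gives an element that does not commute with [i]. *)
have [c [d [c0 d0 cd]]] : exists a b : int, [/\ 0 < a, 0 < b & a ^+ 2 - 3 * (p.-1%:Z * b) ^+ 2 = 1].
  by apply: exists_pell3; case: (p) p1 => [|[|]].
have [|F GF Fx] := @quat_SL2P R p (c, d * - (p%:Z + 1), 0, d * 2).
  rewrite -[RHS]cd /=; have -> : p.-1%:Z = p%:Z - 1 by lia.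
  ring.
have [m [_ /quat_PSL2_conj[Y' [y' Y'y] YE]]] := expS F GF.
have [|||c' [d' [c'0 d'0 Yy]]] := @quat_SL2_exp p F c d (- (p%:Z + 1)) 2 m _ _ _ Fx => //.
  have -> : (- (p%:Z + 1)) ^+ 2 - p%:Z * 2 ^+ 2 = (p%:Z - 1) ^+ 2 by ring.
  exact: sqr_ge0.
rewrite mulr1 mulr0 in Xx.
apply: (@quat_SL2_not_conjugate p q _ _ _ _ _ _ _ _ _ _ pi qi pq _ _ Xx Yy X'x Y'y XE YE).
  by rewrite gt_eqF.
by rewrite /= xpair_eqE /= mulf_neq0 ?andbF // gt_eqF.
Qed.

End Commensurability.

(** * The infinite family *)

Lemma commensurable_refl (R : realType) (G : set (PSL2 R)) : group_closed (mem G) -> commensurable G G.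
Proof.
move=> GG; exists 1%g.
have -> : conjugate G 1%g = G.
  apply/seteqP; split=> [_ [x Gx <-]|x Gx]; first by rewrite mul1g invg1 mulg1.
  by exists x; rewrite ?mul1g ?invg1 ?mulg1.
rewrite setIid; suff fin : finite_index G G by [].
apply: (sub_finite_set _ (finite_set1 G)) => _ [g Gg <-] /=.
apply/seteqP; split=> [_ [s Gs <-]|x Gx].
  by have GM := group_closedM GG; have := GM g s; rewrite !inE; exact.
exists (g^-1 * x)%g; last by rewrite mulVKg.
have GM := group_closedM GG; have := GM g^-1%g x; rewrite !inE; apply=> //.
by have GV := group_closedV GG; have := GV g; rewrite !inE; exact.
Qed.

Lemma infinite_inert3 : infinite_set inert3.
Proof.
move=> /finite_seqP[s sE]; have [p pi] := exists_inert3 (\max_(i <- s) i)%N.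
rewrite ltnNge => /negP; apply.
have ps : p \in s by move: pi; rewrite sE.
exact: (@leq_bigmax_seq _ s xpredT id p ps isT).
Qed.

Theorem proposition5p1 (R : realType) (K : fieldExtType rat)
    (iota : {rmorphism K -> R}) (sqrt3 : K) (d : nat)
    (hsqrt3 : sqrt3 ^+ 2 = 3)
    (hdeg : \dim_(<<1; sqrt3>>%VS) {: K} = d) (hd : (1 <= d)%N)
    (hK : totally_real R K) :
  exists F : set (set (PSL2 R)),
    [/\ infinite_set F,
        forall G, F G ->
          [/\ fuchsian G, cocompact G, semi_arithmetic G & G `<=` PSL2_over iota] &
        forall G1 G2, F G1 -> F G2 -> G1 <> G2 -> ~ commensurable G1 G2].
Proof.
exists [set quat_PSL2 R p | p in inert3]; split.
(* Equal groups are commensurable, so distinct primes give distinct groups. *)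
- have inj : {in (inert3 : set nat) &, injective (quat_PSL2 R)}.
    move=> p q /set_mem pi /set_mem qi pqE; apply/eqP/negPn/negP => pq.
    apply: (@not_commensurable R p q pi qi pq); rewrite -pqE.
    by apply: commensurable_refl; exact: group_quat_PSL2.
  by rewrite (eq_finite_set (inj_card_eq inj)); exact: infinite_inert3.
- move=> _ [p pi <-]; have p0 : (0 < p)%N := prime_gt0 pi.1.
  split; [exact: fuchsian_quat_PSL2|exact: cocompact_quat_PSL2| |exact: quat_PSL2_over hsqrt3].
  split; [exact: fuchsian_quat_PSL2|exact: finite_area_quat_PSL2| |].
    rewrite invariant_trace_field_quat_PSL2; exact: totally_real_range_rat.
  exact: algebraic_integer_quat_PSL2.
- move=> _ _ [p pi <-] [q qi <-] pqE; apply: not_commensurable => //.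
  by apply/eqP => pq; apply: pqE; rewrite pq.
Qed.
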